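(* Let $R$ and $S$ be $F$-finite noetherian $\mathbb{F}_p$-algebras and let $f\colon \operatorname{Spec} S\to \operatorname{Spec} R$ be a finite dominant morphism. Let $\mathcal{C}$ be a Cartier $R$-algebra and $M$ a Cartier $\mathcal{C}$-module. Let $f^!M=\operatorname{Hom}_R(S,M)$ with its induced structure of Cartier $f^*\mathcal{C}$-module, and let $\operatorname{Tr}_M\colon f_*f^!M\to M$, $\mu\mapsto\mu(1)$, be evaluation at $1$. Then $$\operatorname{Tr}_M\big(f_*\tau(f^!M,f^*\mathcal{C})\big)=\tau(M,\mathcal{C}).$$ In particular, $\operatorname{Tr}_M$ is surjective if $(M,\mathcal{C})$ is $F$-regular. Conversely, if $\operatorname{Tr}_M$ is surjective and $(f^!M,f^*\mathcal{C})$ is $F$-regular, then $(M,\mathcal{C})$ is $F$-regular.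
   Context: Throughout $p$ is a prime, $F^e$ is the $e$-th iterated Frobenius, $q=p^e$; $f_*$ denotes restriction of scalars along $R\to S$. Cartier algebras and modules. A Cartier $R$-algebra is an $\mathbb{N}$-graded ring $\mathcal{C}=\bigoplus_{e\ge0}\mathcal{C}_e$ with $\mathcal{C}_0=R$ and $r\cdot\kappa=\kappa\cdot r^{q}$ for all $r\in R$, $\kappa\in\mathcal{C}_e$. Put $\mathcal{C}_+=\bigoplus_{e\ge1}\mathcal{C}_e$. A Cartier $\mathcal{C}$-module is a left $\mathcal{C}$-module $M$ that is finitely generated as an $R$-module; equivalently a finitely generated $R$-module $M$ with a homomorphism of Cartier algebras $\mathcal{C}\to\mathcal{C}_M$, where $\mathcal{C}_M=\bigoplus_e\operatorname{Hom}_R(F^e_*M,M)$ (degree $0$ part replaced by $R$) is the full Cartier algebra of $M$, with product $\varphi_e\cdot\varphi_d=\varphi_e\circ F^e_*\varphi_d$. Pullbacks. $f^*\mathcal{C}$ is the Cartier $S$-algebra $\mathcal{C}\otimes_RS=\bigoplus_e\mathcal{C}_e\otimes_RS$ (tensor product with respect to the right $R$-module structure of $\mathcal{C}_e$), with left $S$-structure $s\cdot(\kappa_e\otimes s')=\kappa_e\otimes s^{q}s'$. It acts on $f^!M=\operatorname{Hom}_R(S,M)$ by $\big((\kappa_e\otimes s')\cdot\mu\big)(s)=\kappa_e\cdot\mu(s's^{q})$. Test modules. A morphism of Cartier $\mathcal{C}$-modules is a nil-isomorphism if its kernel and cokernel are annihilated by some power of $\mathcal{C}_+$. For a prime $\eta$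 and a module $N$, $H^0_\eta(N_\eta)$ is the submodule of $\eta$-power torsion elements of $N_\eta$, a Cartier module over the localized algebra $\mathcal{C}_\eta=\mathcal{C}\otimes_RR_\eta$. The test module $\tau(M,\mathcal{C})$ is the smallest Cartier $\mathcal{C}$-submodule $N\subset M$ such that $H^0_\eta(N_\eta)\to H^0_\eta(M_\eta)$ is a nil-isomorphism for all $\eta\in\operatorname{Ass}M$ (the notation presupposes that this smallest submodule exists). $(M,\mathcal{C})$ is $F$-regular if $\tau(M,\mathcal{C})=M$. *)

(* Defs.v *)
From HB Require Import structures.
From mathcomp Require Import all_boot all_algebra ring.
From mathcomp Require Import boolp classical_sets functions.

Set Implicit Arguments.
Unset Strict Implicit.
Unset Printing Implicit Defensive.

Import GRing.Theory.
Local Open Scope ring_scope.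
Local Open Scope quotient_scope.
Local Open Scope classical_set_scope.

(* Rings are commutative with unit, the zero ring included ([comPzRingType]). *)

Definition is_ideal (R : comPzRingType) (I : set R) : Prop :=
  [/\ I 0, forall x y, I x -> I y -> I (x + y) & forall r x, I x -> I (r * x)].

Definition is_prime_ideal (R : comPzRingType) (P : set R) : Prop :=
  [/\ is_ideal P, ~ P 1 & forall x y, P (x * y) -> P x \/ P y].

Record prime_ideal (R : comPzRingType) := PrimeIdeal {
  prime_set :> set R;
  prime_setP : is_prime_ideal prime_set
}.

Definition lspan (R : comPzRingType) (M : lmodType R) (s : seq M) : set M :=
  [set x | exists c : nat -> R, x = \sum_(i < size s) c i *: s`_i].

Definition fin_gen (R : comPzRingType) (M : lmodType R) : Prop :=
  exists s : seq M, lspan s = setT.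

Definition noetherian (R : comPzRingType) : Prop :=
  forall I : set R, is_ideal I -> exists s : seq R^o, I = lspan s.

Definition char_p (p : nat) (R : comPzRingType) : Prop := p%:R = 0 :> R.

Definition F_finite (p : nat) (R : comPzRingType) : Prop :=
  exists s : seq R, forall x : R,
    exists c : nat -> R, x = \sum_(i < size s) c i ^+ p * s`_i.

Section Frobenius.
Variables (p : nat) (R : comPzRingType).
Hypotheses (p_pr : prime p) (chR : char_p p R).

Lemma frobD e (x y : R) : (x + y) ^+ (p ^ e) = x ^+ (p ^ e) + y ^+ (p ^ e).
Proof.
elim: e x y => [|e IH] x y; first by rewrite !expr1.
rewrite expnS mulnC !exprM IH; set a := x ^+ _; set b := y ^+ _.
have p0 := prime_gt0 p_pr; rewrite -(prednK p0) exprDn.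
rewrite big_ord_recl big_ord_recr /= /bump /= big1 ?addr0 ?add0r; last first.
  move=> i _; rewrite prednK //; set k := (1 + i)%N.
  have /dvdnP[c ->] : (p %| 'C(p, k))%N.
    by apply: prime_dvd_bin => //; rewrite /k add1n /= -ltn_predRL.
  by rewrite mulnC mulrnA -[_ *+ p]mulr_natr chR mulr0 mul0rn.
rewrite add1n prednK // subn0 subnn bin0 binn !expr0 mulr1 mul1r !mulr1n.
by [].
Qed.

End Frobenius.

(* Restriction of scalars [f_* N]. *)
Definition restr (R S : comPzRingType) (f : {rmorphism R -> S})
  (N : lmodType S) : Type := N.

Section Restr.
Variables (R S : comPzRingType) (f : {rmorphism R -> S}) (N : lmodType S).

HB.instance Definition _ := GRing.Zmodule.on (restr f N).

Let rs (r : R) (x : restr f N) : restr f N := f r *: (x : N).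
Let rsA a b v : rs a (rs b v) = rs (a * b) v.
Proof. by rewrite /rs scalerA rmorphM. Qed.
Let rs1 : left_id 1 rs.
Proof. by move=> x; rewrite /rs rmorph1 scale1r. Qed.
Let rsDr : right_distributive rs +%R.
Proof. by move=> r x y; apply: scalerDr. Qed.
Let rsDl v : {morph rs^~ v : a b / a + b}.
Proof. by move=> a b; rewrite /rs rmorphD; apply: scalerDl. Qed.
HB.instance Definition _ :=
  GRing.Zmodule_isLmodule.Build R (restr f N) rsA rs1 rsDr rsDl.

Lemma restr_scaleE (r : R) (x : N) : r *: (x : restr f N) = f r *: x.
Proof. by []. Qed.

End Restr.

Definition finite_morphism (R S : comPzRingType) (f : {rmorphism R -> S}) :
  Prop := fin_gen (restr f S^o).

(* Every Zariski-closed subset [V(I)] of [Spec R] that contains the image of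
   [Spec S] is all of [Spec R]. *)
Definition dominant (R S : comPzRingType) (f : {rmorphism R -> S}) : Prop :=
  forall I : set R, is_ideal I ->
    (forall Q : prime_ideal S, I `<=` f @^-1` Q) ->
    forall P : prime_ideal R, I `<=` P.

(* The tensor product [A (x)_R B]: formal sums of pairs, modulo the congruence
   generated by the bilinearity relations. *)
Section Tensor.
Variables (R : comPzRingType) (A B : lmodType R).

Inductive tens_rel : seq (A * B) -> seq (A * B) -> Prop :=
| tens_refl u : tens_rel u u
| tens_sym u v : tens_rel u v -> tens_rel v u
| tens_trans u v w : tens_rel u v -> tens_rel v w -> tens_rel u w
| tens_cat u u' v v' : tens_rel u u' -> tens_rel v v' ->
    tens_rel (u ++ v) (u' ++ v')
| tens_catC u v : tens_rel (u ++ v) (v ++ u)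
| tens_0l b : tens_rel [:: (0, b)] [::]
| tens_Dl a a' b : tens_rel [:: (a + a', b)] [:: (a, b); (a', b)]
| tens_Dr a b b' : tens_rel [:: (a, b + b')] [:: (a, b); (a, b')]
| tens_bal r a b : tens_rel [:: (r *: a, b)] [:: (a, r *: b)].

Let trel (u v : seq (A * B)) : bool := `[< tens_rel u v >].

Let trel_refl : reflexive trel.
Proof. by move=> u; apply/asboolP/tens_refl. Qed.
Let trel_sym : symmetric trel.
Proof. by move=> u v; apply/asboolP/asboolP => /tens_sym. Qed.
Let trel_trans : transitive trel.
Proof.
by move=> v u w /asboolP uv /asboolP vw; apply/asboolP/(tens_trans uv).
Qed.

Canonical tens_equiv := EquivRel trel trel_refl trel_sym trel_trans.

Definition tensor := {eq_quot tens_equiv}.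
HB.instance Definition _ := Choice.on tensor.
HB.instance Definition _ := EqQuotient.on tensor.

Let piP u v : tens_rel u v -> \pi_tensor u = \pi_tensor v.
Proof. by move=> uv; apply/(@eqquotP _ tens_equiv tensor); apply/asboolP. Qed.
Let reprP u : tens_rel (repr (\pi_tensor u)) u.
Proof. by apply/asboolP; apply/(@eqquotP _ tens_equiv tensor); rewrite reprK. Qed.

Let piK (x : tensor) : exists u, x = \pi_tensor u.
Proof. by exists (repr x); rewrite reprK. Qed.

Let add (x y : tensor) : tensor := \pi_tensor (repr x ++ repr y).
Let oppf (ab : A * B) := (- ab.1, ab.2).
Let opp (x : tensor) : tensor := \pi_tensor (map oppf (repr x)).

Let add_pi u v : add (\pi_tensor u) (\pi_tensor v) = \pi_tensor (u ++ v).
Proof. by apply: piP; apply: tens_cat; apply: reprP. Qed.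

Let addA : associative add.
Proof.
move=> x y z; have [u ->] := piK x; have [v ->] := piK y.
by have [w ->] := piK z; rewrite !add_pi catA.
Qed.
Let addC : commutative add.
Proof.
move=> x y; have [u ->] := piK x; have [v ->] := piK y; rewrite !add_pi.
exact/piP/tens_catC.
Qed.
Let add0 : left_id (\pi_tensor [::]) add.
Proof. by move=> x; have [u ->] := piK x; rewrite add_pi. Qed.
Let addN : left_inverse (\pi_tensor [::]) opp add.
Proof.
move=> x.
have -> : add (opp x) x = \pi_tensor (map oppf (repr x) ++ repr x).
  by rewrite -add_pi reprK.
apply: piP; elim: (repr x) => [|[a b] u IH] /=; first exact: tens_refl.
apply: (@tens_trans _ ([:: (- a, b); (a, b)] ++ (map oppf u ++ u))).
  rewrite -[_ :: _ ++ _]/([:: (- a, b)] ++ (map oppf u ++ ([:: (a, b)] ++ u))).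
  rewrite -[_ ++ (map _ _ ++ u)]/([:: (- a, b)] ++ ([:: (a, b)] ++ (map oppf u ++ u))).
  apply: tens_cat; first exact: tens_refl.
  rewrite !catA; apply: tens_cat; last exact: tens_refl.
  exact: tens_catC.
rewrite -[[::]]/([::] ++ [::]); apply: tens_cat => //.
apply: (@tens_trans _ [:: (- a + a, b)]); first exact/tens_sym/tens_Dl.
by rewrite addNr; apply: tens_0l.
Qed.
HB.instance Definition _ := GRing.isZmodule.Build tensor addA addC add0 addN.

Definition tens (a : A) (b : B) : tensor := \pi_tensor [:: (a, b)].

Lemma tensDl a a' b : tens (a + a') b = tens a b + tens a' b.
Proof. by rewrite /tens [RHS]add_pi; apply/piP/tens_Dl. Qed.
Lemma tensDr a b b' : tens a (b + b') = tens a b + tens a b'.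
Proof. by rewrite /tens [RHS]add_pi; apply/piP/tens_Dr. Qed.
Lemma tensZ r a b : tens (r *: a) b = tens a (r *: b).
Proof. exact/piP/tens_bal. Qed.

Lemma tensor_ind (P : tensor -> Prop) : P 0 ->
  (forall a b, P (tens a b)) -> (forall x y, P x -> P y -> P (x + y)) ->
  forall x, P x.
Proof.
move=> P0 Pt PD x; have [u ->] := piK x; elim: u => [|[a b] u IH] //.
rewrite -[_ :: _]/([:: (a, b)] ++ u) -add_pi.
exact: (PD (tens a b) (\pi_tensor u) (Pt a b) IH).
Qed.

(* The map out of the tensor product induced by a balanced biadditive map. *)
Definition tens_lift (Z : zmodType) (beta : A -> B -> Z) (x : tensor) : Z :=
  \sum_(ab <- repr x) beta ab.1 ab.2.

Section Lift.
Variables (Z : zmodType) (beta : A -> B -> Z).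
Hypothesis bDl : forall a a' b, beta (a + a') b = beta a b + beta a' b.
Hypothesis bDr : forall a b b', beta a (b + b') = beta a b + beta a b'.
Hypothesis bZ : forall r a b, beta (r *: a) b = beta a (r *: b).

Let lift_pi u : tens_lift beta (\pi_tensor u) = \sum_(ab <- u) beta ab.1 ab.2.
Proof.
rewrite /tens_lift; move: (repr _) (reprP u) => u'; elim => //.
- by move=> v w z _ -> _ ->.
- by move=> v v' w w' _ IH1 _ IH2; rewrite !big_cat IH1 IH2.
- by move=> v w; rewrite !big_cat /= addrC.
- move=> b; rewrite big_seq1 big_nil /=.
  by apply: (addrI (beta 0 b)); rewrite -bDl !addr0.
- by move=> a a' b; rewrite big_seq1 !big_cons big_nil /= addr0 bDl.
- by move=> a a' b; rewrite big_seq1 !big_cons big_nil /= addr0 bDr.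
- by move=> r a b; rewrite !big_seq1 bZ.
Qed.

Lemma tens_liftE a b : tens_lift beta (tens a b) = beta a b.
Proof. by rewrite lift_pi big_seq1. Qed.
Lemma tens_liftD x y :
  tens_lift beta (x + y) = tens_lift beta x + tens_lift beta y.
Proof.
have [u ->] := piK x; have [v ->] := piK y.
have -> : \pi_tensor u + \pi_tensor v = \pi_tensor (u ++ v) by apply: add_pi.
by rewrite !lift_pi big_cat.
Qed.
Lemma tens_lift0 : tens_lift beta 0 = 0.
Proof. by apply: (addrI (tens_lift beta 0)); rewrite -tens_liftD !addr0. Qed.

End Lift.
End Tensor.

(* A Cartier algebra is given by its homogeneous pieces [C e].  The product of
   [C e] and [C d] lands in [C n] for any [n] provably equal to [e + d]: this
   avoids transporting along equations such as [e + 0 = e].  [cscal]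
   identifies [R] with the piece of degree 0. *)
Record cartier_algebra (p : nat) (R : comPzRingType) := CartierAlgebra {
  piece :> nat -> zmodType;
  cmul : forall e d n, (e + d)%N = n -> piece e -> piece d -> piece n;
  cscal : R -> piece 0;
  cartier_prime : prime p;
  cartier_char : char_p p R;
  cmulDl : forall e d n (h : (e + d)%N = n) a a' b,
    cmul h (a + a') b = cmul h a b + cmul h a' b;
  cmulDr : forall e d n (h : (e + d)%N = n) a b b',
    cmul h a (b + b') = cmul h a b + cmul h a b';
  cmulA : forall e d g ed dg n (h1 : (e + d)%N = ed) (h2 : (ed + g)%N = n)
      (h3 : (d + g)%N = dg) (h4 : (e + dg)%N = n) a b c,
    cmul h4 a (cmul h3 b c) = cmul h2 (cmul h1 a b) c;
  cmul1l : forall e (h : (0 + e)%N = e) a, cmul h (cscal 1) a = a;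
  cmul1r : forall e (h : (e + 0)%N = e) a, cmul h a (cscal 1) = a;
  cscalD : forall r s, cscal (r + s) = cscal r + cscal s;
  cscalM : forall (h : (0 + 0)%N = 0%N) r s,
    cscal (r * s) = cmul h (cscal r) (cscal s);
  cscal_bij : bijective cscal;
  ccomm : forall e (hl : (0 + e)%N = e) (hr : (e + 0)%N = e) r a,
    cmul hl (cscal r) a = cmul hr a (cscal (r ^+ (p ^ e)))
}.

(* A (graded) left [C]-module.  The [R]-module structure is the restriction of
   the action to degree 0; finite generation over [R] is not included. *)
Record cmodule (p : nat) (R : comPzRingType) (C : cartier_algebra p R) :=
  CModule {
  cmod_car :> lmodType R;
  act : forall e, C e -> cmod_car -> cmod_car;
  actDl : forall e (a b : C e) m, act (a + b) m = act a m + act b m;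
  actDr : forall e (a : C e) m n, act a (m + n) = act a m + act a n;
  actM : forall e d n (h : (e + d)%N = n) (a : C e) (b : C d) m,
    act (cmul h a b) m = act a (act b m);
  act_scal : forall r m, act (cscal C r) m = r *: m
}.

Section CartierBasics.
Variables (p : nat) (R : comPzRingType) (C : cartier_algebra p R).

Lemma cmul0l e d n (h : (e + d)%N = n) (b : C d) : cmul h 0 b = 0 :> C n.
Proof. by apply: (addrI (cmul h 0 b)); rewrite -cmulDl !addr0. Qed.
Lemma cmul0r e d n (h : (e + d)%N = n) (a : C e) : cmul h a 0 = 0 :> C n.
Proof. by apply: (addrI (cmul h a 0)); rewrite -cmulDr !addr0. Qed.
Lemma act0l (M : cmodule C) e (m : M) : act (0 : C e) m = 0.
Proof. by apply: (addrI (act (0 : C e) m)); rewrite -actDl !addr0. Qed.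
Lemma act0r (M : cmodule C) e (a : C e) : act a (0 : M) = 0.
Proof. by apply: (addrI (act a (0 : M))); rewrite -actDr !addr0. Qed.

Lemma act_semilin (M : cmodule C) e (a : C e) (r : R) (m : M) :
  r *: act a m = act a (r ^+ (p ^ e) *: m).
Proof.
by rewrite -act_scal -(actM (add0n e)) (ccomm _ (addn0 e)) actM act_scal.
Qed.

End CartierBasics.

(* The piece [C e] with its right [R]-module structure. *)
Definition rpiece (p : nat) (R : comPzRingType) (C : cartier_algebra p R)
  (e : nat) : Type := C e.

Section RPiece.
Variables (p : nat) (R : comPzRingType) (C : cartier_algebra p R) (e : nat).

HB.instance Definition _ := GRing.Zmodule.on (rpiece C e).

Let rs (r : R) (a : rpiece C e) : rpiece C e := cmul (addn0 e) a (cscal C r).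
Let rsA a b v : rs a (rs b v) = rs (a * b) v.
Proof.
by rewrite /rs mulrC (cscalM _ (addn0 0)) (cmulA (addn0 e) (addn0 e)).
Qed.
Let rs1 : left_id 1 rs.
Proof. by move=> x; apply: cmul1r. Qed.
Let rsDr : right_distributive rs +%R.
Proof. by move=> r x y; apply: cmulDl. Qed.
Let rsDl v : {morph rs^~ v : a b / a + b}.
Proof. by move=> a b; rewrite /rs cscalD; apply: cmulDr. Qed.
HB.instance Definition _ :=
  GRing.Zmodule_isLmodule.Build R (rpiece C e) rsA rs1 rsDr rsDl.

Lemma rpiece_scaleE (r : R) (a : C e) :
  r *: (a : rpiece C e) = cmul (addn0 e) a (cscal C r).
Proof. by []. Qed.

End RPiece.

(* The pullback [f^* C]: the piece of degree [e] is [C e (x)_R S], and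
   [(a (x) s) * (b (x) t) = a * b (x) s^(p^d) t] for [b] of degree [d]. *)
Section Pullback.
Variables (p : nat) (R S : comPzRingType) (f : {rmorphism R -> S}).
Variable C : cartier_algebra p R.

Definition pb_piece (e : nat) : zmodType := tensor (rpiece C e) (restr f S^o).

Definition pb_tens e (a : C e) (s : S) : pb_piece e :=
  @tens R (rpiece C e) (restr f S^o) a s.

Definition pb_mul e d n (h : (e + d)%N = n) (x : pb_piece e) (y : pb_piece d) :
    pb_piece n :=
  tens_lift (fun (a : rpiece C e) (s : restr f S^o) =>
    tens_lift (fun (b : rpiece C d) (t : restr f S^o) =>
      pb_tens (cmul h (a : C e) (b : C d))
        ((s : S) ^+ (p ^ d) * (t : S))) y) x.

Definition pb_scal (s : S) : pb_piece 0 := pb_tens (cscal C 1) s.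

Lemma pullback_prime : prime p. Proof. exact: cartier_prime C. Qed.

Lemma pullback_char : char_p p S.
Proof.
by rewrite /char_p -(rmorph_nat f) (cartier_char C : p%:R = 0 :> R) rmorph0.
Qed.

Lemma pb_tensDl e (a b : C e) s :
  pb_tens (a + b) s = pb_tens a s + pb_tens b s.
Proof. exact: tensDl. Qed.
Lemma pb_tensDr e (a : C e) s t :
  pb_tens a (s + t) = pb_tens a s + pb_tens a t.
Proof. exact: (@tensDr R (rpiece C e) (restr f S^o)). Qed.
Lemma pb_tensZ e (h : (e + 0)%N = e) (a : C e) r s :
  pb_tens (cmul h a (cscal C r)) s = pb_tens a (f r * s).
Proof.
rewrite (_ : h = addn0 e); last exact: eq_irrelevance.
exact: (@tensZ R (rpiece C e) (restr f S^o)).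
Qed.

Lemma pb_mulDl e d n (h : (e + d)%N = n) x x' y :
  pb_mul h (x + x') y = pb_mul h x y + pb_mul h x' y.
Proof.
apply: tens_liftD.
- move=> a a' s; rewrite /tens_lift -big_split; apply: eq_bigr => -[b t] _ /=.
  by rewrite [cmul _ _ _]cmulDl pb_tensDl.
- move=> a s s'; rewrite /tens_lift -big_split; apply: eq_bigr => -[b t] _ /=.
  by rewrite frobD ?pullback_prime ?mulrDl ?pb_tensDr //; apply: pullback_char.
- move=> r a s; rewrite /tens_lift; apply: eq_bigr => -[b t] _ /=.
  rewrite rpiece_scaleE restr_scaleE -(cmulA _ _ (add0n d)).
  rewrite (ccomm _ (addn0 d)) (cmulA h (addn0 n)) pb_tensZ.
  by rewrite rmorphXn [_ *: _]/(f r * s) exprMn mulrA.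
Qed.

Let innerD e d n (h : (e + d)%N = n) (a : C e) (s : S) (y y' : pb_piece d) :
  let F := fun (b : rpiece C d) (t : restr f S^o) =>
      pb_tens (cmul h (a : C e) (b : C d))
        ((s : S) ^+ (p ^ d) * (t : S)) in
  tens_lift F (y + y') = tens_lift F y + tens_lift F y' /\
  (forall b t, tens_lift F (pb_tens b t) = F b t).
Proof.
move=> F.
have FDl b b' t : F (b + b') t = F b t + F b' t.
  by rewrite /F [cmul _ _ _]cmulDr pb_tensDl.
have FDr b t t' : F b (t + t') = F b t + F b t'.
  by rewrite /F mulrDr pb_tensDr.
have FZ r b t : F (r *: b) t = F b (r *: t).
  rewrite /F rpiece_scaleE restr_scaleE (cmulA h (addn0 n)) pb_tensZ.
  by rewrite [_ *: _]/(f r * t) mulrCA.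
by split=> [|b t]; [apply: tens_liftD | apply: tens_liftE].
Qed.

Lemma pb_mulDr e d n (h : (e + d)%N = n) x y y' :
  pb_mul h x (y + y') = pb_mul h x y + pb_mul h x y'.
Proof.
rewrite /pb_mul {2 4}/tens_lift [in RHS]/tens_lift -big_split.
by apply: eq_bigr => -[a s] _; case: (innerD h a s y y').
Qed.

Lemma pb_mulE e d n (h : (e + d)%N = n) (a : C e) (b : C d) s t :
  pb_mul h (pb_tens a s) (pb_tens b t)
  = pb_tens (cmul h a b) (s ^+ (p ^ d) * t).
Proof.
rewrite -(innerD h a s 0 0).2; apply: tens_liftE.
- move=> a1 a' s1; rewrite /tens_lift -big_split; apply: eq_bigr => -[b1 t1] _ /=.
  by rewrite [cmul _ _ _]cmulDl pb_tensDl.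
- move=> a1 s1 s'; rewrite /tens_lift -big_split; apply: eq_bigr => -[b1 t1] _ /=.
  by rewrite frobD ?pullback_prime ?mulrDl ?pb_tensDr //; apply: pullback_char.
- move=> r a1 s1; rewrite /tens_lift; apply: eq_bigr => -[b1 t1] _ /=.
  rewrite rpiece_scaleE restr_scaleE -(cmulA _ _ (add0n d)).
  rewrite (ccomm _ (addn0 d)) (cmulA h (addn0 n)) pb_tensZ.
  by rewrite rmorphXn [_ *: _]/(f r * s1) exprMn mulrA.
Qed.

Lemma pb_ind e (P : pb_piece e -> Prop) : P 0 ->
  (forall a s, P (pb_tens a s)) -> (forall x y, P x -> P y -> P (x + y)) ->
  forall x, P x.
Proof. exact: (@tensor_ind R (rpiece C e) (restr f S^o) P). Qed.

Let mul0l e d n (h : (e + d)%N = n) y : pb_mul h 0 y = 0.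
Proof. by apply: (addrI (pb_mul h 0 y)); rewrite -pb_mulDl !addr0. Qed.
Let mul0r e d n (h : (e + d)%N = n) x : pb_mul h x 0 = 0.
Proof. by apply: (addrI (pb_mul h x 0)); rewrite -pb_mulDr !addr0. Qed.

Lemma pb_mulA e d g ed dg n (h1 : (e + d)%N = ed) (h2 : (ed + g)%N = n)
    (h3 : (d + g)%N = dg) (h4 : (e + dg)%N = n) x y z :
  pb_mul h4 x (pb_mul h3 y z) = pb_mul h2 (pb_mul h1 x y) z.
Proof.
elim/pb_ind: x => [|a s|x x' IH IH']; first by rewrite !mul0l.
  elim/pb_ind: y => [|b t|y y' IH IH']; first by rewrite mul0r !mul0l !mul0r.
    elim/pb_ind: z => [|c u|z z' IH IH']; first by rewrite !mul0r.
      rewrite !pb_mulE (cmulA h1 h2) exprMn -exprM -expnD h3.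
      by rewrite mulrA.
    by rewrite !pb_mulDr IH IH'.
  by rewrite pb_mulDl !pb_mulDr pb_mulDl IH IH'.
by rewrite !pb_mulDl IH IH'.
Qed.

Lemma pb_mul1l e (h : (0 + e)%N = e) x : pb_mul h (pb_scal 1) x = x.
Proof.
elim/pb_ind: x => [|a s|x x' IH IH']; first by rewrite mul0r.
  by rewrite pb_mulE cmul1l expr1n mul1r.
by rewrite pb_mulDr IH IH'.
Qed.

Lemma pb_mul1r e (h : (e + 0)%N = e) x : pb_mul h x (pb_scal 1) = x.
Proof.
elim/pb_ind: x => [|a s|x x' IH IH']; first by rewrite mul0l.
  by rewrite pb_mulE cmul1r expr1 mulr1.
by rewrite pb_mulDl IH IH'.
Qed.

Lemma pb_scalD s t : pb_scal (s + t) = pb_scal s + pb_scal t.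
Proof. exact: pb_tensDr. Qed.

Lemma pb_scalM (h : (0 + 0)%N = 0%N) s t :
  pb_scal (s * t) = pb_mul h (pb_scal s) (pb_scal t).
Proof. by rewrite pb_mulE cmul1l expr1. Qed.

Lemma pb_scal_bij : bijective pb_scal.
Proof.
have [g gK Kg] := cscal_bij C.
have gD a b : g (a + b) = g a + g b.
  by apply: (can_inj gK); rewrite cscalD !Kg.
have gM a b : g (cmul (addn0 0) a b) = g a * g b.
  by apply: (can_inj gK); rewrite (cscalM C (addn0 0)) !Kg.
pose beta (a : rpiece C 0) (s : restr f S^o) : S := f (g a) * (s : S).
have bDl a a' s : beta (a + a') s = beta a s + beta a' s.
  by rewrite /beta [g _]gD rmorphD mulrDl.
have bDr a s s' : beta a (s + s') = beta a s + beta a s'.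
  by rewrite /beta mulrDr.
have bZ r a s : beta (r *: a) s = beta a (r *: s).
  by rewrite /beta rpiece_scaleE gM gK rmorphM -mulrA.
exists (tens_lift beta) => [s|x].
  rewrite [LHS](tens_liftE bDl bDr bZ) /beta.
  by rewrite [g _]gK rmorph1 mul1r.
elim/pb_ind: x => [|a s|x x' IH IH'].
- rewrite (tens_lift0 bDl bDr bZ).
  by apply: (addrI (pb_scal 0)); rewrite -pb_scalD !addr0.
- rewrite (tens_liftE bDl bDr bZ) /beta /pb_scal -(pb_tensZ (addn0 0)).
  by rewrite cmul1l Kg.
- by rewrite (tens_liftD bDl bDr bZ) pb_scalD IH IH'.
Qed.

Lemma pb_comm e (hl : (0 + e)%N = e) (hr : (e + 0)%N = e) s x :
  pb_mul hl (pb_scal s) x = pb_mul hr x (pb_scal (s ^+ (p ^ e))).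
Proof.
elim/pb_ind: x => [|a t|x x' IH IH']; first by rewrite mul0l mul0r.
  by rewrite !pb_mulE cmul1l cmul1r expr1 mulrC.
by rewrite pb_mulDl pb_mulDr IH IH'.
Qed.

Definition pullback : cartier_algebra p S :=
  @CartierAlgebra p S pb_piece pb_mul pb_scal pullback_prime pullback_char
    pb_mulDl pb_mulDr pb_mulA pb_mul1l pb_mul1r pb_scalD pb_scalM pb_scal_bij
    pb_comm.

(* An [S]-module [L] with semilinear operators [a e c], [c] in [C e], becomes
   an [f^* C]-module through [(c (x) s) . x = a e c (s x)]. *)
Section Extend.
Variables (L : lmodType S) (a : forall e, C e -> L -> L).
Hypothesis aDl : forall e (c d : C e) x, a (c + d) x = a c x + a d x.
Hypothesis aDr : forall e (c : C e) x y, a c (x + y) = a c x + a c y.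
Hypothesis aM : forall e d n (h : (e + d)%N = n) (b : C e) (c : C d) x,
  a (cmul h b c) x = a b (a c x).
Hypothesis a_scal : forall r x, a (cscal C r) x = f r *: x.
Hypothesis a_semi : forall e (c : C e) s x,
  s *: a c x = a c (s ^+ (p ^ e) *: x).

Definition ext_act e (k : pullback e) (x : L) : L :=
  tens_lift (fun (c : rpiece C e) (s : restr f S^o) =>
    a (c : C e) ((s : S) *: x)) k.

Let bal e x (F := fun (c : rpiece C e) (s : restr f S^o) =>
    a (c : C e) ((s : S) *: x)) :
  [/\ forall c c' s, F (c + c') s = F c s + F c' s,
      forall c s s', F c (s + s') = F c s + F c s' &
      forall r c s, F (r *: c) s = F c (r *: s)].
Proof.
split=> *; rewrite /F.
- by rewrite [LHS]aDl.
- by rewrite scalerDl aDr.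
- by rewrite rpiece_scaleE aM a_scal scalerA.
Qed.

Lemma ext_actE e (c : C e) s x : @ext_act e (pb_tens c s) x = a c (s *: x).
Proof. by have [Dl Dr Z] := bal e x; apply: (tens_liftE Dl Dr Z). Qed.

Lemma ext_actDl e (k k' : pullback e) x :
  ext_act (k + k') x = ext_act k x + ext_act k' x.
Proof. by have [Dl Dr Z] := bal e x; apply: (tens_liftD Dl Dr Z). Qed.

Lemma ext_actDr e (k : pullback e) x y :
  ext_act k (x + y) = ext_act k x + ext_act k y.
Proof.
rewrite /ext_act /tens_lift -big_split; apply: eq_bigr => -[c s] _ /=.
by rewrite scalerDr aDr.
Qed.

Let ext0l e x : ext_act (0 : pullback e) x = 0.
Proof. by apply: (addrI (@ext_act e 0 x)); rewrite -ext_actDl !addr0. Qed.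
Let ext0r e (k : pullback e) : ext_act k 0 = 0.
Proof. by apply: (addrI (ext_act k 0)); rewrite -ext_actDr !addr0. Qed.

Lemma ext_actM e d n (h : (e + d)%N = n) (k : pullback e) (l : pullback d) x :
  ext_act (cmul h k l) x = ext_act k (ext_act l x).
Proof.
move: k; apply: pb_ind => [|b s|k k' IH IH'].
- by rewrite cmul0l !ext0l.
- move: l; apply: pb_ind => [|c t|l l' IH IH'].
  + by rewrite cmul0r !ext0l ext0r.
  + by rewrite [cmul _ _ _]pb_mulE !ext_actE aM a_semi scalerA.
  + by rewrite cmulDr !ext_actDl ext_actDr IH IH'.
- by rewrite cmulDl !ext_actDl IH IH'.
Qed.

Lemma ext_act_scal s x : ext_act (cscal pullback s) x = s *: x.
Proof. by rewrite [LHS]ext_actE a_scal rmorph1 scale1r. Qed.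

Definition ext_cmodule : cmodule pullback :=
  @CModule p S pullback L ext_act ext_actDl ext_actDr ext_actM ext_act_scal.

End Extend.
End Pullback.

Record csubmod (p : nat) (R : comPzRingType) (C : cartier_algebra p R)
  (M : cmodule C) := CSubmod {
  csub_set :> set M;
  csub0 : csub_set 0;
  csubD : forall x y, csub_set x -> csub_set y -> csub_set (x + y);
  csub_act : forall e (a : C e) x, csub_set x -> csub_set (act a x)
}.

Section SubModule.
Variables (p : nat) (R : comPzRingType) (C : cartier_algebra p R).
Variables (M : cmodule C) (N : csubmod M).

Definition csub_pred : {pred M} := fun x => `[< csub_set N x >].
Definition csub_car : Type := {x : M | csub_pred x}.

Lemma csub_closed : GRing.subsemimod_closed csub_pred.
Proof.
split; first split.
- by apply/asboolP; apply: csub0.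
- by move=> x y /asboolP Nx /asboolP Ny; apply/asboolP/csubD.
- by move=> r x /asboolP Nx; apply/asboolP; rewrite -act_scal; apply: csub_act.
Qed.

HB.instance Definition _ := [isSub of csub_car for @sval M csub_pred].
HB.instance Definition _ := [Choice of csub_car by <:].
HB.instance Definition _ :=
  GRing.SubChoice_isSubLmodule.Build R M csub_pred csub_car csub_closed.

Lemma csub_actP e (a : C e) (x : csub_car) : csub_pred (act a (val x)).
Proof. by apply/asboolP/csub_act/asboolP/(valP x). Qed.

Definition csub_act_fun e (a : C e) (x : csub_car) : csub_car :=
  Sub (act a (val x)) (csub_actP a x).

Lemma csub_actDl e (a b : C e) x :
  csub_act_fun (a + b) x = csub_act_fun a x + csub_act_fun b x.
Proof. by apply: val_inj; rewrite [RHS]raddfD /=; apply: actDl. Qed.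
Lemma csub_actDr e (a : C e) x y :
  csub_act_fun a (x + y) = csub_act_fun a x + csub_act_fun a y.
Proof. by apply: val_inj; rewrite [RHS]raddfD /= -actDr; congr (act a _). Qed.
Lemma csub_actM e d n (h : (e + d)%N = n) (a : C e) (b : C d) x :
  csub_act_fun (cmul h a b) x = csub_act_fun a (csub_act_fun b x).
Proof. by apply: val_inj; apply: actM. Qed.
Lemma csub_act_scal r x : csub_act_fun (cscal C r) x = r *: x.
Proof. by apply: val_inj; rewrite [RHS]linearZ /= act_scal. Qed.

Definition csub_cmodule : cmodule C :=
  @CModule p R C csub_car csub_act_fun csub_actDl csub_actDr csub_actM
    csub_act_scal.

End SubModule.

Record chom (p : nat) (R : comPzRingType) (C : cartier_algebra p R)
  (M N : cmodule C) := CHom {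
  chom_fun :> M -> N;
  chomD : forall x y, chom_fun (x + y) = chom_fun x + chom_fun y;
  chom_act : forall e (a : C e) x, chom_fun (act a x) = act a (chom_fun x)
}.

Section Hom.
Variables (p : nat) (R : comPzRingType) (C : cartier_algebra p R).

Lemma chomZ (M N : cmodule C) (g : chom M N) r x : g (r *: x) = r *: g x.
Proof. by rewrite -!act_scal chom_act. Qed.

Lemma chom0 (M N : cmodule C) (g : chom M N) : g 0 = 0.
Proof. by apply: (addrI (g 0)); rewrite -chomD !addr0. Qed.

Lemma csub_incl_act (M : cmodule C) (N : csubmod M) e (a : C e)
  (x : csub_cmodule N) : val (act a x) = act a (val x).
Proof. exact: SubK. Qed.

Definition csub_incl (M : cmodule C) (N : csubmod M) :
    chom (csub_cmodule N) M :=
  @CHom p R C (csub_cmodule N) M val (raddfD val) (@csub_incl_act M N).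

(* The homogeneous elements of [C_+ ^ k].  This ideal is graded, so it
   annihilates a module as soon as its homogeneous elements do. *)
Inductive plus_pow : nat -> forall e, C e -> Prop :=
| plus_pow0 e (a : C e) : plus_pow 0 a
| plus_powM k e d n (h : (e + d)%N = n) (a : C e) (b : C d) :
    (0 < e)%N -> plus_pow k b -> plus_pow k.+1 (cmul h a b)
| plus_pow_zero k e : plus_pow k (0 : C e)
| plus_powD k e (a b : C e) :
    plus_pow k a -> plus_pow k b -> plus_pow k (a + b).

Definition nil_isomorphism (M N : cmodule C) (g : chom M N) : Prop :=
  (exists k, forall e (a : C e), plus_pow k a ->
     forall x, g x = 0 -> act a x = 0) /\
  (exists k, forall e (a : C e), plus_pow k a ->
     forall y, exists x, g x = act a y).

End Hom.

(* Localization [M_P] of a module at a prime: fractions [m / t], [t] not in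
   [P]. *)
Section Localization.
Variables (R : comPzRingType) (P : prime_ideal R).

Definition den_pred (t : R) : bool := `[< ~ prime_set P t >].
Definition den : Type := {t : R | den_pred t}.
HB.instance Definition _ := Choice.on den.

Lemma denP (t : den) : ~ prime_set P (sval t).
Proof. exact/asboolP/(svalP t). Qed.

Lemma den1_subproof : den_pred 1.
Proof. by apply/asboolP; case: (prime_setP P). Qed.
Definition den1 : den := exist den_pred 1 den1_subproof.

Lemma denM_subproof (t u : den) : den_pred (sval t * sval u).
Proof.
apply/asboolP => Ptu; have [_ _ /(_ _ _ Ptu)] := prime_setP P.
by case; apply: denP.
Qed.
Definition denM (t u : den) : den := exist den_pred _ (denM_subproof t u).

Lemma den_eq (t u : den) : sval t = sval u -> t = u.
Proof. exact: val_inj. Qed.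

Section Module.
Variable M : lmodType R.

Definition frac_rel (x y : M * den) : bool :=
  `[< exists u : den,
        sval u *: (sval y.2 *: x.1) = sval u *: (sval x.2 *: y.1) >].

Let frel_refl : reflexive frac_rel.
Proof. by move=> x; apply/asboolP; exists den1. Qed.
Let frel_sym : symmetric frac_rel.
Proof. by move=> x y; apply/asboolP/asboolP => -[u e]; exists u. Qed.
Let frel_trans : transitive frac_rel.
Proof.
move=> [l s] [m t] [n v] /asboolP[/= u e] /asboolP[/= u' e'].
apply/asboolP; exists (denM (denM u u') s) => /=.
transitivity ((sval u' * sval v) *: (sval u *: (sval s *: m))).
  by rewrite !scalerA; congr (_ *: _); ring.
transitivity ((sval u * sval t) *: (sval u' *: (sval v *: l))).
  by rewrite e !scalerA; congr (_ *: _); ring.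
by rewrite e' !scalerA; congr (_ *: _); ring.
Qed.
Canonical frac_equiv := EquivRel frac_rel frel_refl frel_sym frel_trans.

Definition loc := {eq_quot frac_equiv}.
HB.instance Definition _ := Choice.on loc.
HB.instance Definition _ := EqQuotient.on loc.

Definition frac (m : M) (t : den) : loc := \pi_loc (m, t).

Lemma frac_ex (x : loc) : exists m t, x = frac m t.
Proof.
by exists (repr x).1, (repr x).2; rewrite /frac -surjective_pairing reprK.
Qed.

Lemma frac_eqP m t n s : frac m t = frac n s <->
  exists u : den, sval u *: (sval s *: m) = sval u *: (sval t *: n).
Proof.
split=> [/(@eqquotP _ frac_equiv loc)/asboolP //|h].
by apply/(@eqquotP _ frac_equiv loc); apply/asboolP.
Qed.

Lemma frac_eq m t n s : sval s *: m = sval t *: n -> frac m t = frac n s.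
Proof. by move=> e; apply/frac_eqP; exists den1; rewrite e. Qed.

Lemma frac_repr (T : Type) (F : M -> den -> T) :
  (forall m t n s, frac m t = frac n s -> F m t = F n s) ->
  forall m t, F (repr (frac m t)).1 (repr (frac m t)).2 = F m t.
Proof.
by move=> h m t; apply: h; rewrite /frac -surjective_pairing reprK.
Qed.

Let add_fun (m : M) (t : den) (n : M) (s : den) : loc :=
  frac (sval s *: m + sval t *: n) (denM t s).
Let add (x y : loc) : loc :=
  add_fun (repr x).1 (repr x).2 (repr y).1 (repr y).2.
Let opp (x : loc) : loc := frac (- (repr x).1) (repr x).2.

Let add_compat m t m' t' n s n' s' :
  frac m t = frac m' t' -> frac n s = frac n' s' ->
  add_fun m t n s = add_fun m' t' n' s'.
Proof.
move=> /frac_eqP[u e] /frac_eqP[v e']; apply/frac_eqP.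
exists (denM u v) => /=; rewrite !scalerDr.
congr (_ + _).
  transitivity ((sval v * sval s * sval s') *: (sval u *: (sval t' *: m))).
    by rewrite !scalerA; congr (_ *: _); ring.
  by rewrite e !scalerA; congr (_ *: _); ring.
transitivity ((sval u * sval t * sval t') *: (sval v *: (sval s' *: n))).
  by rewrite !scalerA; congr (_ *: _); ring.
by rewrite e' !scalerA; congr (_ *: _); ring.
Qed.

Let addE m t n s : add (frac m t) (frac n s) = add_fun m t n s.
Proof.
by apply: add_compat; rewrite /frac -surjective_pairing reprK.
Qed.

Let oppE m t : opp (frac m t) = frac (- m) t.
Proof.
apply: (@frac_repr _ (fun m t => frac (- m) t)) => {m t} m t n s.
by move=> /frac_eqP[u e]; apply/frac_eqP; exists u; rewrite !scalerN e.
Qed.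

Let addA : associative add.
Proof.
move=> x y z; have [m [t ->]] := frac_ex x; have [n [s ->]] := frac_ex y.
have [l [r ->]] := frac_ex z; rewrite !addE /add_fun ?addE /add_fun.
apply: frac_eq => /=; rewrite !scalerDr !addrA !scalerA.
by congr (_ + _ + _); congr (_ *: _); ring.
Qed.
Let addC : commutative add.
Proof.
move=> x y; have [m [t ->]] := frac_ex x; have [n [s ->]] := frac_ex y.
rewrite !addE /add_fun; apply: frac_eq => /=; rewrite addrC !scalerDr !scalerA.
by congr (_ + _); congr (_ *: _); ring.
Qed.
Let add0 : left_id (frac 0 den1) add.
Proof.
move=> x; have [m [t ->]] := frac_ex x; rewrite addE; apply: frac_eq => /=.
by rewrite scaler0 add0r scale1r mul1r.
Qed.
Let addN : left_inverse (frac 0 den1) opp add.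
Proof.
move=> x; have [m [t ->]] := frac_ex x; rewrite oppE addE; apply: frac_eq.
by rewrite /= scalerN addNr !scaler0.
Qed.
HB.instance Definition _ := GRing.isZmodule.Build loc addA addC add0 addN.

Lemma fracD m t n s :
  frac m t + frac n s = frac (sval s *: m + sval t *: n) (denM t s).
Proof. exact: addE. Qed.

Lemma frac0 t : frac 0 t = 0.
Proof. by apply: frac_eq; rewrite !scaler0. Qed.

Lemma frac_addl m n t : frac (m + n) t = frac m t + frac n t.
Proof.
rewrite fracD; apply: frac_eq => /=; rewrite !scalerDr !scalerA.
by congr (_ + _); congr (_ *: _); ring.
Qed.

End Module.

Section LScale.
Variable M : lmodType R.

Let lsc_fun (r : R^o) (t : den) (m : M) (s : den) : loc M :=
  frac ((r : R) *: m) (denM t s).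
Definition loc_scale (a : loc R^o) (x : loc M) : loc M :=
  lsc_fun (repr a).1 (repr a).2 (repr x).1 (repr x).2.

Lemma loc_scaleE (r : R^o) t (m : M) s :
  loc_scale (frac r t) (frac m s) = frac ((r : R) *: m) (denM t s).
Proof.
have compat (r1 : R^o) t1 m1 s1 r2 t2 m2 s2 :
    frac r1 t1 = frac r2 t2 -> frac m1 s1 = frac m2 s2 ->
    lsc_fun r1 t1 m1 s1 = lsc_fun r2 t2 m2 s2.
  move=> /frac_eqP[u e] /frac_eqP[v e']; apply/frac_eqP.
  exists (denM u v) => /=.
  transitivity ((sval u * (sval t2 * r1)) *: (sval v *: (sval s2 *: m1))).
    by rewrite !scalerA; congr (_ *: _); ring.
  have -> : sval u * (sval t2 * r1) = sval u * (sval t1 * r2) by [].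
  by rewrite e' !scalerA; congr (_ *: _); ring.
by apply: compat; rewrite /frac -surjective_pairing reprK.
Qed.

Lemma loc_scaleDr a : {morph loc_scale a : x y / x + y}.
Proof.
move=> x y; have [m [t ->]] := frac_ex x; have [n [s ->]] := frac_ex y.
have [r [w ->]] := frac_ex a; rewrite fracD !loc_scaleE fracD.
apply: frac_eq => /=; rewrite !scalerDr !scalerA.
by congr (_ + _); congr (_ *: _); ring.
Qed.

Lemma loc_scaleDl x : {morph loc_scale^~ x : a b / a + b}.
Proof.
move=> a b; have [m [t ->]] := frac_ex x; have [n [s ->]] := frac_ex a.
have [r [w ->]] := frac_ex b; rewrite fracD !loc_scaleE fracD.
apply: frac_eq => /=; rewrite !scalerA -scalerDl scalerA.
by congr (_ *: _); rewrite /GRing.scale /=; ring.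
Qed.

Lemma loc_scale1 : left_id (frac (1 : R^o) den1) loc_scale.
Proof.
move=> x; have [m [t ->]] := frac_ex x; rewrite loc_scaleE.
by apply: frac_eq; rewrite /= scale1r mul1r.
Qed.

End LScale.

Lemma loc_scaleA (M : lmodType R) (a b : loc R^o) (x : loc M) :
  loc_scale a (loc_scale b x) = loc_scale (loc_scale a b) x.
Proof.
have [m [t ->]] := frac_ex x; have [n [s ->]] := frac_ex a.
have [r [w ->]] := frac_ex b.
rewrite (loc_scaleE r w m t) (loc_scaleE n s _ _).
rewrite (@loc_scaleE R^o n s r w) (@loc_scaleE M _ _ m t).
apply: frac_eq => /=; rewrite !scalerA.
by congr (_ *: _); rewrite /GRing.scale /=; ring.
Qed.

Lemma loc_scaleC (a b : loc R^o) : loc_scale a b = loc_scale b a.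
Proof.
have [n [s ->]] := frac_ex a; have [r [w ->]] := frac_ex b.
rewrite !loc_scaleE; apply: frac_eq => /=.
by rewrite /GRing.scale /=; ring.
Qed.

(* The local ring [R_P]: the product is the scaling of [R_P] on itself. *)
Definition locring : Type := loc R^o.
HB.instance Definition _ := GRing.Zmodule.on locring.
HB.instance Definition _ := GRing.Zmodule_isComPzRing.Build locring
  (@loc_scaleA R^o) loc_scaleC (@loc_scale1 R^o)
  (fun a b x => @loc_scaleDl R^o x a b).

HB.instance Definition _ (M : lmodType R) :=
  GRing.Zmodule_isLmodule.Build locring (loc M)
    (@loc_scaleA M) (@loc_scale1 M) (@loc_scaleDr M) (@loc_scaleDl M).

Definition locfrac (r : R) (t : den) : locring := frac (r : R^o) t.

Lemma locfrac_scale (M : lmodType R) r t (m : M) s :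
  locfrac r t *: frac m s = frac (r *: m) (denM t s).
Proof. exact: loc_scaleE. Qed.

Lemma locfracM r t r' t' :
  locfrac r t * locfrac r' t' = locfrac (r * r') (denM t t').
Proof. exact: (@loc_scaleE R^o). Qed.

Definition locmap (r : R) : locring := locfrac r den1.

Lemma locmap_is_zmod : zmod_morphism locmap.
Proof.
move=> r s; apply: (addIr (locmap s)); rewrite subrK /locmap /locfrac.
by rewrite -frac_addl subrK.
Qed.
Lemma locmap_is_monoid : monoid_morphism locmap.
Proof.
split=> [//|r s]; rewrite /locmap locfracM; congr locfrac.
by apply: den_eq; rewrite /= mulr1.
Qed.
HB.instance Definition _ := GRing.isZmodMorphism.Build R locring locmap
  locmap_is_zmod.
HB.instance Definition _ := GRing.isMonoidMorphism.Build R locring locmap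
  locmap_is_monoid.

End Localization.

(* The localized algebra [C_P = C (x)_R R_P], and the localization [M_P] of a
   [C]-module [M] as a [C_P]-module: [c] in [C e] sends [m / t] to
   [c (t^(q-1) m) / t] with [q = p^e]. *)
Section LocCartier.
Variables (p : nat) (R : comPzRingType) (C : cartier_algebra p R).
Variable P : prime_ideal R.

Definition loc_alg : cartier_algebra p (locring P) := pullback (@locmap R P) C.

Section LocModule.
Variable M : cmodule C.

Let q_gt0 e : (0 < p ^ e)%N.
Proof. by rewrite expn_gt0 prime_gt0 // (cartier_prime C). Qed.

Definition loc_op e (c : C e) (x : loc P M) : loc P M :=
  let: (m, t) := repr x in frac (act c (sval t ^+ (p ^ e).-1 *: m)) t.

Let loc_op0 e (c : C e) (m : M) (t : den P) : loc P M :=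
  frac (act c (sval t ^+ (p ^ e).-1 *: m)) t.

Lemma loc_opE e (c : C e) (m : M) (t : den P) :
  loc_op c (frac m t) = frac (act c (sval t ^+ (p ^ e).-1 *: m)) t.
Proof.
have -> : loc_op c (frac m t)
    = loc_op0 c (repr (frac m t)).1 (repr (frac m t)).2.
  by rewrite /loc_op; case: (repr _).
apply: (@frac_repr R P M _ (loc_op0 c)) => {m t} m t n s /frac_eqP[u h].
apply/frac_eqP; exists u; rewrite !scalerA !act_semilin !scalerA.
congr act; have := q_gt0 e; case: (p ^ e)%N => //= q _.
rewrite !exprMn.
transitivity ((sval u ^+ q * sval s ^+ q * sval t ^+ q) *:
   (sval u *: (sval s *: m))).
  by rewrite !scalerA; congr (_ *: _); rewrite !exprS; ring.
by rewrite h !scalerA; congr (_ *: _); rewrite !exprS; ring.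
Qed.

Lemma loc_opDl e (c d : C e) x : loc_op (c + d) x = loc_op c x + loc_op d x.
Proof.
by have [m [t ->]] := frac_ex x; rewrite !loc_opE actDl frac_addl.
Qed.

Lemma loc_opDr e (c : C e) x y : loc_op c (x + y) = loc_op c x + loc_op c y.
Proof.
have [m [t ->]] := frac_ex x; have [n [s ->]] := frac_ex y.
rewrite fracD !loc_opE fracD.
congr (frac _ _); rewrite !act_semilin -actDr scalerDr !scalerA.
congr act; have := q_gt0 e; case: (p ^ e)%N => //= q _.
by congr (_ *: _ + _ *: _); rewrite exprMn exprS; ring.
Qed.

Lemma loc_opM e d n (h : (e + d)%N = n) (b : C e) (c : C d) x :
  loc_op (cmul h b c) x = loc_op b (loc_op c x).
Proof.
have [m [t ->]] := frac_ex x; rewrite !loc_opE actM act_semilin scalerA.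
congr (frac (act b (act c (_ *: m))) t).
rewrite -exprM -exprD -h expnD; congr (_ ^+ _).
have := q_gt0 e; have := q_gt0 d; case: (p ^ e)%N => // i.
by case: (p ^ d)%N => // j _ _; rewrite mulSn /= addnC.
Qed.

Lemma loc_op_scal r x : loc_op (cscal C r) x = locmap P r *: x.
Proof.
have [m [t ->]] := frac_ex x; rewrite loc_opE locfrac_scale act_scal expr0.
by apply: frac_eq; rewrite /= scale1r mul1r.
Qed.

Lemma loc_op_semi e (c : C e) (s : locring P) x :
  s *: loc_op c x = loc_op c (s ^+ (p ^ e) *: x).
Proof.
have fX (r : R) (t : den P) i : exists2 w : den P, sval w = sval t ^+ i &
    locfrac r t ^+ i = locfrac (r ^+ i) w.
  elim: i => [|i [w ew IH]]; first by exists (den1 P).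
  by exists (denM t w); rewrite ?exprS ?IH ?locfracM //= ew.
have [m [t ->]] := frac_ex x; have [r [u ->]] := frac_ex s.
rewrite loc_opE locfrac_scale.
have [w ew ->] := fX r u (p ^ e)%N.
rewrite locfrac_scale loc_opE; apply: frac_eq => /=.
rewrite !scalerA !act_semilin !scalerA; congr act; congr (_ *: _).
rewrite ew; have := q_gt0 e; case: (p ^ e)%N => //= q _.
by rewrite ?exprMn !exprS; ring.
Qed.

Definition loc_cmodule : cmodule loc_alg :=
  @ext_cmodule p R (locring P) (@locmap R P) C (loc P M) loc_op
    loc_opDl loc_opDr loc_opM loc_op_scal loc_op_semi.

Lemma loc_actE e (c : C e) (s : locring P) (x : loc P M) :
  act (pb_tens (@locmap R P) c s : loc_alg e) (x : loc_cmodule)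
  = loc_op c (s *: x).
Proof.
exact: (ext_actE loc_opDl loc_opDr loc_opM loc_op_scal).
Qed.

End LocModule.

Section LocHom.
Variables (M N : cmodule C) (g : chom M N).

Definition loc_hom_fun (x : loc_cmodule M) : loc_cmodule N :=
  let: (m, t) := repr (x : loc P M) in (frac (g m) t : loc P N).

Lemma loc_hom_funE (m : M) (t : den P) :
  loc_hom_fun (frac m t : loc P M) = (frac (g m) t : loc P N).
Proof.
have -> : loc_hom_fun (frac m t : loc P M)
    = frac (g (repr (frac m t)).1) (repr (frac m t)).2.
  by rewrite /loc_hom_fun; case: (repr _).
apply: (@frac_repr R P M _ (fun m t => frac (g m) t)) => {m t} m t n s.
move=> /frac_eqP[u h]; apply/frac_eqP; exists u.
by rewrite -!chomZ h.
Qed.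

Lemma loc_hom_funD x y : loc_hom_fun (x + y) = loc_hom_fun x + loc_hom_fun y.
Proof.
have [m [t ->]] := frac_ex (x : loc P M).
have [n [s ->]] := frac_ex (y : loc P M).
have e1 := fracD m t n s; have e2 := fracD (g m) t (g n) s.
rewrite -[LHS]/(loc_hom_fun ((frac m t : loc P M) + (frac n s : loc P M))) e1.
by rewrite !loc_hom_funE [RHS]e2 -!chomZ -chomD.
Qed.

Lemma loc_hom_fun_act e (c : loc_alg e) x :
  loc_hom_fun (act c x) = act c (loc_hom_fun x).
Proof.
have h0 : loc_hom_fun 0 = 0.
  by apply: (addrI (loc_hom_fun 0)); rewrite -loc_hom_funD !addr0.
move: c; apply: pb_ind => [|c s|c c' IH IH'].
- by rewrite !act0l h0.
- rewrite [act _ x]loc_actE [RHS]loc_actE.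
  have [m [t ->]] := frac_ex (x : loc P M); have [r [u ->]] := frac_ex s.
  rewrite loc_hom_funE !locfrac_scale !loc_opE loc_hom_funE.
  by rewrite chom_act !chomZ.
- by rewrite !actDl loc_hom_funD IH IH'.
Qed.

Definition loc_hom : chom (loc_cmodule M) (loc_cmodule N) :=
  @CHom p _ loc_alg _ _ loc_hom_fun loc_hom_funD loc_hom_fun_act.

End LocHom.

(* [H^0_P]: elements killed by all products of [n] elements of [P], for some
   [n], hence by the ideal [P^n]. *)
Section H0.
Variable N : cmodule loc_alg.

Definition P_power_torsion (x : N) : Prop :=
  exists n, forall s : seq R, size s = n -> (forall r, r \in s -> prime_set P r) ->
    locmap P (\prod_(r <- s) r) *: x = 0.

Lemma torsion0 : P_power_torsion 0.
Proof. by exists 0%N => s _ _; rewrite scaler0. Qed.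

Lemma torsionD x y :
  P_power_torsion x -> P_power_torsion y -> P_power_torsion (x + y).
Proof.
move=> [n hn] [k hk]; exists (n + k)%N => s ss Ps.
rewrite -(cat_take_drop n s) big_cat /= rmorphM scalerDr.
have s1 : size (take n s) = n by rewrite size_takel // ss leq_addr.
have s2 : size (drop n s) = k by rewrite size_drop ss addKn.
rewrite {1}mulrC -!scalerA (hn _ s1) ?(hk _ s2) ?scaler0 ?addr0 //.
- by move=> r /mem_drop; apply: Ps.
- by move=> r /mem_take; apply: Ps.
Qed.

Lemma torsion_act e (a : loc_alg e) x :
  P_power_torsion x -> P_power_torsion (act a x).
Proof.
move=> [n hn]; exists n => s ss Ps; rewrite act_semilin.
have : (0 < p ^ e)%N by rewrite expn_gt0 prime_gt0 // (cartier_prime C).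
case: (p ^ e)%N => // q _; rewrite exprSr -scalerA hn // scaler0.
exact: act0r.
Qed.

Definition H0 : csubmod N :=
  @CSubmod p _ loc_alg N P_power_torsion torsion0 torsionD torsion_act.

End H0.

Section H0Hom.
Variables (M N : cmodule loc_alg) (g : chom M N).

Lemma H0_hom_subproof (x : csub_cmodule (H0 M)) :
  csub_pred (H0 N) (g (val x)).
Proof.
have [n hn] : csub_set (H0 M) (val x) by apply/asboolP/(valP x).
by apply/asboolP; exists n => s ss Ps; rewrite -chomZ hn // chom0.
Qed.

Definition H0_hom_fun (x : csub_cmodule (H0 M)) : csub_cmodule (H0 N) :=
  Sub (g (val x)) (H0_hom_subproof x).

Lemma H0_hom_funD x y : H0_hom_fun (x + y) = H0_hom_fun x + H0_hom_fun y.
Proof.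
apply: val_inj; rewrite [RHS]raddfD /= -chomD.
by congr (g _).
Qed.

Lemma H0_hom_fun_act e (a : loc_alg e) x :
  H0_hom_fun (act a x) = act a (H0_hom_fun x).
Proof. by apply: val_inj; rewrite /= -chom_act. Qed.

Definition H0_hom : chom (csub_cmodule (H0 M)) (csub_cmodule (H0 N)) :=
  @CHom p _ loc_alg _ _ H0_hom_fun H0_hom_funD H0_hom_fun_act.

End H0Hom.
End LocCartier.

Definition Ass (R : comPzRingType) (M : lmodType R) : set (prime_ideal R) :=
  [set P : prime_ideal R |
    exists m : M, prime_set P = [set r : R | r *: m = 0]].

Section TestModule.
Variables (p : nat) (R : comPzRingType) (C : cartier_algebra p R).
Variable M : cmodule C.

Definition H0_nil_iso (N : csubmod M) : Prop :=
  forall P : prime_ideal R, Ass M P ->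
    nil_isomorphism (H0_hom (loc_hom P (csub_incl N))).

(* [tau(M, C)] is rendered as a relation: [N] is the test module of [M].  It
   is unique when it exists. *)
Definition is_test_module (N : csubmod M) : Prop :=
  H0_nil_iso N /\ forall N' : csubmod M, H0_nil_iso N' -> N `<=` N'.

Definition F_regular : Prop :=
  exists N : csubmod M, is_test_module N /\ (N : set M) = setT.

End TestModule.

(* [f^! M = Hom_R(S, M)]. *)
Section UpperShriek.
Variables (p : nat) (R S : comPzRingType) (f : {rmorphism R -> S}).
Variables (C : cartier_algebra p R) (M : cmodule C).

Definition homR_pred : {pred S -> M} := fun g =>
  `[< forall (r : R) (x y : S), g (f r * x + y) = r *: g x + g y >].

Definition homR : Type := {g : S -> M | homR_pred g}.

Lemma homR_closed : zmod_closed homR_pred.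
Proof.
split; first by apply/asboolP => r x y; rewrite scaler0 addr0.
move=> g h /asboolP gl /asboolP hl; apply/asboolP => r x y.
by rewrite !fctE gl hl scalerBr opprD !addrA; congr (_ + _); rewrite -!addrA;
  congr (_ + _); rewrite addrC.
Qed.

HB.instance Definition _ := [isSub of homR for @sval (S -> M) homR_pred].
HB.instance Definition _ := [Choice of homR by <:].
HB.instance Definition _ :=
  GRing.SubChoice_isSubZmodule.Build (S -> M) homR_pred homR homR_closed.

Definition homR_app (g : homR) (x : S) : M := val g x.

Lemma homR_lin (g : homR) r x y :
  homR_app g (f r * x + y) = r *: homR_app g x + homR_app g y.
Proof. by move: r x y; apply/asboolP/(valP g). Qed.

Lemma homR_ext (g h : homR) : homR_app g =1 homR_app h -> g = h.
Proof. by move=> e; apply/val_inj/funext. Qed.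

Lemma homR_appD (g h : homR) x :
  homR_app (g + h) x = homR_app g x + homR_app h x.
Proof. by rewrite /homR_app raddfD. Qed.

Lemma homR_addr (g : homR) x y :
  homR_app g (x + y) = homR_app g x + homR_app g y.
Proof. by have := homR_lin g 1 x y; rewrite rmorph1 mul1r scale1r. Qed.

Lemma homR_0 (g : homR) : homR_app g 0 = 0.
Proof. by apply: (addrI (homR_app g 0)); rewrite -homR_addr !addr0. Qed.

Lemma homR_scale (g : homR) r x : homR_app g (f r * x) = r *: homR_app g x.
Proof. by have := homR_lin g r x 0; rewrite homR_0 !addr0. Qed.

Lemma homR_scale_subproof (s : S) (g : homR) :
  homR_pred (fun x => homR_app g (x * s)).
Proof.
by apply/asboolP => r x y; rewrite mulrDl -mulrA homR_lin.
Qed.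

Definition homR_smul (s : S) (g : homR) : homR := Sub _ (homR_scale_subproof s g).

Let smulE s g x : homR_app (homR_smul s g) x = homR_app g (x * s).
Proof. by []. Qed.

Let sA a b v : homR_smul a (homR_smul b v) = homR_smul (a * b) v.
Proof. by apply: homR_ext => x; rewrite !smulE mulrA. Qed.
Let s1 : left_id 1 homR_smul.
Proof. by move=> g; apply: homR_ext => x; rewrite !smulE mulr1. Qed.
Let sDr : right_distributive homR_smul +%R.
Proof. by move=> s g h; apply: homR_ext => x; rewrite !(homR_appD, smulE). Qed.
Let sDl v : {morph homR_smul^~ v : a b / a + b}.
Proof.
by move=> s t; apply: homR_ext => x; rewrite homR_appD !smulE mulrDr homR_addr.
Qed.
HB.instance Definition _ :=
  GRing.Zmodule_isLmodule.Build S homR sA s1 sDr sDl.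

Let S_prime : prime p. Proof. exact: cartier_prime C. Qed.
Let S_char : char_p p S. Proof. exact: (pullback_char f C). Qed.

Lemma shriek_op_subproof e (c : C e) (g : homR) :
  homR_pred (fun x => act c (homR_app g (x ^+ (p ^ e)))).
Proof.
apply/asboolP => r x y.
rewrite frobD // exprMn -rmorphXn homR_addr homR_scale actDr.
by rewrite -act_semilin.
Qed.

(* [c] in [C e] sends [g] to [x |-> c (g (x^q))]; together with the [S]-module
   structure this gives [((c (x) s) . g) x = c (g (s x^q))]. *)
Definition shriek_op e (c : C e) (g : homR) : homR :=
  Sub _ (shriek_op_subproof c g).

Let opE e (c : C e) g x :
  homR_app (shriek_op c g) x = act c (homR_app g (x ^+ (p ^ e))).
Proof. by []. Qed.

Lemma shriek_opDl e (c d : C e) g :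
  shriek_op (c + d) g = shriek_op c g + shriek_op d g.
Proof. by apply: homR_ext => x; rewrite homR_appD !opE actDl. Qed.
Lemma shriek_opDr e (c : C e) g h :
  shriek_op c (g + h) = shriek_op c g + shriek_op c h.
Proof. by apply: homR_ext => x; rewrite homR_appD !opE homR_appD actDr. Qed.
Lemma shriek_opM e d n (h : (e + d)%N = n) (b : C e) (c : C d) g :
  shriek_op (cmul h b c) g = shriek_op b (shriek_op c g).
Proof.
by apply: homR_ext => x; rewrite !opE actM -exprM -expnD h.
Qed.
Lemma shriek_op_scal r g : shriek_op (cscal C r) g = f r *: g.
Proof.
by apply: homR_ext => x; rewrite opE expr1 act_scal smulE mulrC homR_scale.
Qed.
Lemma shriek_op_semi e (c : C e) s g :
  s *: shriek_op c g = shriek_op c (s ^+ (p ^ e) *: g).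
Proof. by apply: homR_ext => x; rewrite smulE !opE smulE exprMn. Qed.

Definition upper_shriek : cmodule (pullback f C) :=
  @ext_cmodule p R S f C homR shriek_op shriek_opDl shriek_opDr shriek_opM
    shriek_op_scal shriek_op_semi.

Lemma upper_shriek_actE e (c : C e) (s : S) (g : homR) (x : S) :
  homR_app (act (pb_tens f c s : pullback f C e) (g : upper_shriek)) x
  = act c (homR_app g (s * x ^+ (p ^ e))).
Proof.
rewrite [act _ _](ext_actE shriek_opDl shriek_opDr shriek_opM shriek_op_scal).
by rewrite opE smulE mulrC.
Qed.

Definition Tr (g : upper_shriek) : M := homR_app g 1.

End UpperShriek.

(* Main.v *)
(* Over noetherian rings [H0_nil_iso N] means: for [P] in [Ass M] some power
   [C_+ ^ k] maps every [m] killed by a power of [P] into [N], up to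
   denominators outside [P] ([local_nil] below).

   If [N] in [M] has this property, so does [Hom_R(S, N)] in [f^! M], since
   associated primes of [f^! M] contract to associated primes of [M] and [S] is
   finite over [R]; hence Tr (tau (f^! M)) is contained in tau M.

   Conversely let [T] in [f^! M] have the property, let [P] be in [Ass M] and
   let [Q] lie over [P].  If [P ^ n] kills [m] then [C_+ ^ n] sends [m] to an
   element [m'] killed by [P].  Up to a denominator [m'] is mu(1) for some mu
   that factors through [S / Q]: compose [m'] with a functional on the vector
   space [(S / Q)_P] that is nonzero at 1.  Since [Q] kills mu, a power of [C_+]
   sends mu into [T] up to a denominator, so the same power sends [m'] into
   Tr T.  Thus tau M is contained in Tr (tau (f^! M)). *)
Require Import Defs.
From mathcomp Require Import all_boot all_algebra ring.
From mathcomp Require Import boolp classical_sets functions.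

Set Implicit Arguments.
Unset Strict Implicit.
Unset Printing Implicit Defensive.

Import GRing.Theory.
Local Open Scope ring_scope.
Local Open Scope classical_set_scope.

(** * Submodules and finite linear spans *)

Definition is_submod (R : comPzRingType) (M : lmodType R) (X : set M) : Prop :=
  [/\ X 0, forall x y, X x -> X y -> X (x + y) & forall r x, X x -> X (r *: x)].

Section Submodules.
Variables (R : comPzRingType) (M : lmodType R).
Implicit Type X : set M.

Lemma submodN X x : is_submod X -> X x -> X (- x).
Proof. by move=> [_ _ XZ] /(XZ (-1)); rewrite scaleN1r. Qed.

Lemma submodB X x y : is_submod X -> X x -> X y -> X (x - y).
Proof. by move=> sX Xx /(submodN sX); case: sX => _ XD _; apply: XD. Qed.

Lemma submod_sum X (I : Type) (r : seq I) (F : I -> M) :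
  is_submod X -> (forall i, X (F i)) -> X (\sum_(i <- r) F i).
Proof. by move=> [X0 XD _] XF; elim/big_ind: _. Qed.

Lemma lspan_nil : lspan [::] = [set 0 : M].
Proof.
apply/seteqP; split=> x; first by move=> [c ->]; rewrite big_ord0.
by move=> ->; exists (fun=> 0); rewrite big_ord0.
Qed.

Lemma lspan_cons (a : M) s x :
  lspan (a :: s) x <-> exists r y, lspan s y /\ x = r *: a + y.
Proof.
split=> [[c ->]|[r [y [[c ->] ->]]]].
  rewrite big_ord_recl /=.
  by exists (c 0%N), (\sum_(i < size s) c i.+1 *: s`_i); split => //;
    exists (fun i => c i.+1).
exists (fun i => if i is j.+1 then c j else r).
by rewrite big_ord_recl.
Qed.

Lemma lspan_submod (s : seq M) : is_submod (lspan s).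
Proof.
split.
- by exists (fun=> 0); rewrite big1 // => i _; rewrite scale0r.
- move=> x y [c ->] [d ->]; exists (fun i => c i + d i).
  by rewrite -big_split; apply: eq_bigr => i _; rewrite scalerDl.
- move=> r x [c ->]; exists (fun i => r * c i).
  by rewrite scaler_sumr; apply: eq_bigr => i _; rewrite scalerA.
Qed.

Lemma lspan_sub (s : seq M) X : is_submod X ->
  (forall i, (i < size s)%N -> X s`_i) -> lspan s `<=` X.
Proof.
move=> sX Xs x [c ->]; apply: submod_sum => // i.
by case: sX => _ _; apply; apply: Xs.
Qed.

Lemma lspan_nth (s : seq M) i : (i < size s)%N -> lspan s s`_i.
Proof.
move=> ilt; exists (fun j => (j == i)%:R).
rewrite (bigD1 (Ordinal ilt)) //= eqxx scale1r big1 ?addr0 // => j.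
by rewrite -val_eqE /= => /negPf ->; rewrite scale0r.
Qed.

Lemma lspan_cat (s t : seq M) x y :
  lspan s x -> lspan t y -> lspan (s ++ t) (x + y).
Proof.
elim: s x => [|a s IH] x; first by rewrite lspan_nil => -> ty; rewrite add0r.
move=> /lspan_cons[r [z [sz ->]]] ty; apply/lspan_cons.
by exists r, (z + y); rewrite addrA; split=> //; apply: IH.
Qed.

End Submodules.

(** * Finite generation of submodules over a noetherian ring *)

Section NoetherianModules.
Variables (R : comPzRingType) (noethR : noetherian R) (M : lmodType R).

(** The possible coefficients of [a] in elements of [X] form an ideal. Lifts of its generators,
    joined to generators of the intersection of [X] with [lspan s], generate [X]. *)
Lemma sub_lspan_fin_gen (s : seq M) (X : set M) : is_submod X ->
  X `<=` lspan s -> exists t, X = lspan t.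
Proof.
elim: s X => [|a s IH] X sX Xs.
  exists [::]; rewrite lspan_nil in Xs *; apply/seteqP; split=> // x ->.
  by case: sX.
have [X0 XD XZ] := sX; have [s0 sD sZ] := lspan_submod s.
pose I := [set r : R | exists2 y, lspan s y & X (r *: a + y)].
have idI : is_ideal I.
  split.
  - by exists 0; rewrite ?scale0r ?addr0.
  - move=> r r' [y sy Xy] [y' sy' Xy']; exists (y + y'); first exact: sD.
    by rewrite scalerDl addrACA; apply: XD.
  - move=> r r' [y sy Xy]; exists (r *: y); first exact: sZ.
    by rewrite -scalerA -scalerDr; apply: XZ.
have [g Ig] := noethR idI.
have [||t Xt] := IH (X `&` lspan s); last 1 first.
- have lift i : exists y, (i < size g)%N -> lspan s y /\ X (g`_i *: a + y).
    case: (ltnP i (size g)) => [ig|]; last by exists 0.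
    by have : I g`_i; [rewrite Ig; apply: lspan_nth | case=> y; exists y].
  have [y yP] := choice lift.
  pose u := mkseq (fun i => g`_i *: a + y i) (size g).
  exists (u ++ t); apply/seteqP; split=> [x Xx|].
    have /lspan_cons[r [z [sz xE]]] := Xs _ Xx.
    have : I r by exists z => //; rewrite -xE.
    rewrite Ig => -[c rE].
    pose v := \sum_(i < size g) c i *: u`_i.
    have uv : lspan u v by exists c; rewrite size_mkseq.
    have vE : v = r *: a + \sum_(i < size g) c i *: y i.
      rewrite rE scaler_suml -big_split; apply: eq_bigr => i _ /=.
      by rewrite nth_mkseq // scalerDr scalerA.
    (* The [a]-components cancel in [x - v], which thus lies in both [X] and [lspan s]. *)
    rewrite -(subrK v x) addrC; apply: lspan_cat => //; rewrite -Xt; split.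
      apply: submodB => //; apply: submod_sum => // i; apply: XZ.
      by rewrite nth_mkseq //; case: (yP i (ltn_ord i)).
    rewrite vE xE opprD addrACA subrr add0r.
    have sS := lspan_submod s; apply: submodB => //.
    apply: submod_sum => //.
    by move=> i; apply: sZ; case: (yP i (ltn_ord i)).
  apply: lspan_sub => // i; rewrite size_cat nth_cat size_mkseq.
  case: (ltnP i (size g)) => [ig|ge] ilt.
    by rewrite nth_mkseq //; case: (yP i ig).
  have : lspan t t`_(i - size g).
    by apply: lspan_nth; rewrite ltn_subLR.
  by rewrite -Xt => -[].
- split=> [|x y [Xx sx] [Xy sy]|r x [Xx sx]]; split; auto.
- by move=> x [].
Qed.

End NoetherianModules.

(** * Denominators outside a prime and power torsion *)

Section Denominators.
Variables (R : comPzRingType) (P : prime_ideal R).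

Lemma primeM (r s : R) : ~ prime_set P r -> ~ prime_set P s ->
  ~ prime_set P (r * s).
Proof. by case: (prime_setP P) => _ _ PM nr ns /PM[]. Qed.

Lemma prime1 : ~ prime_set P 1.
Proof. by case: (prime_setP P). Qed.

Lemma primeMl (r s : R) : prime_set P s -> prime_set P (r * s).
Proof. by case: (prime_setP P) => -[_ _ PM] _ _; apply: PM. Qed.

Lemma primeMr (r s : R) : prime_set P r -> prime_set P (r * s).
Proof. by rewrite mulrC; apply: primeMl. Qed.

(** The product of the denominators of the generators serves the whole span. *)
Lemma common_denominator (L : lmodType R) (s : seq L) (X : set L) :
  is_submod X ->
  (forall i, (i < size s)%N -> exists2 a, ~ prime_set P a & X (a *: s`_i)) ->
  exists2 a, ~ prime_set P a & forall x, lspan s x -> X (a *: x).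
Proof.
move=> [X0 XD XZ]; elim: s => [_|b s IH Xs].
  by exists 1 => [|x]; [exact: prime1 | rewrite lspan_nil => ->; rewrite scaler0].
have [//|a' na' Xb] := Xs 0%N.
have [i ilt|a na Xa] := IH; first exact: (Xs i.+1).
exists (a * a'); first exact: primeM.
move=> x /lspan_cons[r [y [sy ->]]]; rewrite scalerDr; apply: XD.
  by rewrite scalerA [_ * r]mulrC -!scalerA; apply/XZ/XZ.
by rewrite mulrC -scalerA; apply/XZ/Xa.
Qed.

(** The condition of [P_power_torsion] with fixed exponent, in [M] itself instead of [M_P]. *)
Definition kills (M : lmodType R) n (x : M) : Prop :=
  forall s : seq R, size s = n -> (forall r, r \in s -> prime_set P r) ->
    (\prod_(r <- s) r) *: x = 0.

(** For a submodule [X] this is the preimage of [X_P] under [M -> M_P]. *)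
Definition saturation (M : lmodType R) (X : set M) : set M :=
  [set x | exists2 u, ~ prime_set P u & X (u *: x)].

Lemma saturation_submod (M : lmodType R) (X : set M) :
  is_submod X -> is_submod (saturation X).
Proof.
move=> [X0 XD XZ]; split.
- by exists 1; [exact: prime1 | rewrite scaler0].
- move=> x y [u nu Xu] [v nv Xv]; exists (u * v); first exact: primeM.
  rewrite scalerDr; apply: XD; last by rewrite -scalerA; apply: XZ.
  by rewrite mulrC -scalerA; apply: XZ.
- move=> r x [u nu Xu]; exists u => //.
  by rewrite scalerA mulrC -scalerA; apply: XZ.
Qed.

Section Kills.
Variable M : lmodType R.

Lemma kills_submod n : is_submod (@kills M n).
Proof.
split.
- by move=> s _ _; rewrite scaler0.
- by move=> x y kx ky s ss sP; rewrite scalerDr kx ?ky ?addr0.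
- by move=> r x kx s ss sP; rewrite scalerA mulrC -scalerA kx ?scaler0.
Qed.

Lemma killsS n (x : M) :
  kills n.+1 x <-> forall r, prime_set P r -> kills n (r *: x).
Proof.
split=> [kx r Pr s ss sP|kx [//|r s] [ss] sP].
  rewrite scalerA mulrC -(big_cons _ _ r s xpredT id) kx //= ?ss // => t.
  by rewrite inE => /orP[/eqP-> //|]; apply: sP.
rewrite big_cons mulrC -scalerA; apply: kx => //.
  by apply: sP; rewrite inE eqxx.
by move=> t ts; apply: sP; rewrite inE ts orbT.
Qed.

Lemma kills_leq n k (x : M) : (n <= k)%N -> kills n x -> kills k x.
Proof.
move=> /subnKC <-; elim: (k - n)%N => [|i IH] kx; first by rewrite addn0.
rewrite addnS; apply/killsS => r _.
by case: (kills_submod (n + i)) => _ _; apply; apply: IH.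
Qed.

(** Induction on [n]: each generator of [P], applied to [x], gets a denominator from the induction
    hypothesis, and finitely many generators share one. *)
Lemma loc_kills (noethR : noetherian R) n (x : M) (t : den P) :
  (forall s : seq R, size s = n -> (forall r, r \in s -> prime_set P r) ->
    locmap P (\prod_(r <- s) r) *: (Defs.frac x t : loc P M) = 0) ->
  exists2 u, ~ prime_set P u & kills n (u *: x).
Proof.
have [idP _ _] := prime_setP P; have [g Pg] := noethR _ idP.
elim: n x => [|n IH] x hx.
  have : (Defs.frac x t : loc P M) = Defs.frac 0 (den1 P).
    rewrite frac0; have := hx [::] erefl.
    by rewrite big_nil rmorph1 scale1r; apply.
  move=> /frac_eqP[u]; rewrite !scaler0 scale1r => ux.
  exists (sval u); first exact: denP.
  by case=> // _ _; rewrite big_nil scale1r.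
have sX : is_submod [set r : R^o | kills n ((r : R) *: x)].
  have [k0 kD kZ] := kills_submod n; split=> [|r s|r s] /=.
  - by rewrite scale0r.
  - by rewrite scalerDl; apply: kD.
  - by rewrite -scalerA; apply: kZ.
have [i ilt|u nu uP] := common_denominator (s := g) sX.
  have Pgi : prime_set P g`_i by rewrite Pg; apply: lspan_nth.
  have [s ss sP|u nu ku] := IH (g`_i *: x).
    have := hx (g`_i :: s) (congr1 succn ss).
    rewrite big_cons !locfrac_scale scalerA mulrC; apply=> r.
    by rewrite inE => /orP[/eqP-> //|]; apply: sP.
  by exists u; rewrite //= -scalerA.
exists u => //; apply/killsS => r Pr.
rewrite scalerA mulrC; apply: uP.
by rewrite -Pg.
Qed.

End Kills.
End Denominators.

(** * Nakayama's lemma at a prime *)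

Section PrimeSpan.
Variables (R : comPzRingType) (P : prime_ideal R) (L : lmodType R).

(** The product of [P] with the span of [s]; the recursion on [s] suits the elimination of
    generators. *)
Fixpoint prime_span (s : seq L) (x : L) : Prop :=
  if s is a :: s' then
    exists r y, [/\ prime_set P r, prime_span s' y & x = r *: a + y]
  else x = 0.

Lemma prime_span_submod s : is_submod (prime_span s).
Proof.
have [[P0 PD PM] _ _] := prime_setP P.
elim: s => [|a s [s0 sD sZ]] /=.
  by split=> [|x y -> ->|r x ->]; rewrite ?addr0 ?scaler0.
split.
- by exists 0, 0; rewrite scale0r addr0.
- move=> x x' [r [y [Pr sy ->]]] [r' [y' [Pr' sy' ->]]].
  exists (r + r'), (y + y'); rewrite scalerDl addrACA.
  by split; [exact: PD | exact: sD | ].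
- move=> c x [r [y [Pr sy ->]]]; exists (c * r), (c *: y).
  by rewrite scalerDr scalerA; split; [exact: PM | exact: sZ | ].
Qed.

Lemma prime_span_sub s (X : set L) : X 0 ->
  (forall x y, X x -> X y -> X (x + y)) ->
  (forall r i, prime_set P r -> (i < size s)%N -> X (r *: s`_i)) ->
  prime_span s `<=` X.
Proof.
move=> X0 XD; elim: s => [_ x -> //|a s IH Xs x [r [y [Pr sy ->]]]].
apply: XD; first exact: (Xs r 0%N).
by apply: IH sy => r' i Pr'; apply: (Xs r' i.+1).
Qed.

Lemma prime_span_scale s r x : prime_set P r -> lspan s x -> prime_span s (r *: x).
Proof.
move=> Pr; elim: s x => [|a s IH] x.
  by rewrite lspan_nil => ->; apply: scaler0.
move=> /lspan_cons[c [y [sy ->]]]; exists (r * c), (r *: y).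
by rewrite scalerDr scalerA; split; [exact: primeMr | exact: IH | ].
Qed.

(* Nakayama's lemma, eliminating the generators one at a time. *)
Lemma nakayama_prime s u : ~ prime_set P u ->
  (forall i, (i < size s)%N -> prime_span s (u *: s`_i)) ->
  exists2 w, ~ prime_set P w & forall x, lspan s x -> w *: x = 0.
Proof.
have [[P0 PD PM] _ _] := prime_setP P.
elim: s u => [|a s IH] u nu us.
  by exists u => // x; rewrite lspan_nil => ->; rewrite scaler0.
have [_ sD sZ] := prime_span_submod s.
have [//|r [y [Pr sy /= uE]]] := us 0%N.
have nv : ~ prime_set P (u - r) by move=> /PD/(_ Pr); rewrite subrK.
have vE : (u - r) *: a = y by rewrite scalerBl uE addrC addKr.
(* Multiplying the other relations by [u - r] replaces [a] by [y], so they involve [s] only. *)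
have [|i ilt|w nw ws] := IH ((u - r) * u); first exact: primeM.
  have [//|r' [y' [Pr' sy' /= u'E]]] := us i.+1.
  rewrite -scalerA u'E scalerDr scalerA mulrC -scalerA vE.
  by apply: sD; apply: sZ.
exists (w * (u - r)); first exact: primeM.
move=> x /lspan_cons[c [z [sz ->]]].
have wy : w *: y = 0.
  apply: (@prime_span_sub s [set y | w *: y = 0]) sy => /=.
  - by rewrite scaler0.
  - by move=> y1 y2 e1 e2; rewrite scalerDr e1 e2 addr0.
  - by move=> r' i _ ilt; rewrite scalerA mulrC -scalerA ws ?scaler0 //;
      apply: lspan_nth.
rewrite scalerDr scalerA [_ * c]mulrC -!scalerA vE wy scaler0 add0r.
by rewrite scalerA mulrC -scalerA ws // scaler0.
Qed.

End PrimeSpan.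

(** * Zorn's lemma, lying over and extension of functionals *)

Lemma max_submod (A : comPzRingType) (M : lmodType A) (J0 D : set M) :
  is_submod J0 -> (forall x, D x -> ~ J0 x) ->
  exists J : set M, [/\ is_submod J, J0 `<=` J, forall x, D x -> ~ J x &
    forall x, ~ J x -> exists a y, J y /\ D (a *: x + y)].
Proof.
move=> sJ0 DJ0.
pose good J := [/\ is_submod J, J0 `<=` J & forall x, D x -> ~ J x].
have gJ0 : good J0 by split.
pose Z J := J = set0 \/ good J.
have [|J [ZJ Jmax]] := @Zorn_bigcup M Z.
  move=> F FZ Ftot.
  have [[J [FJ gJ]]|nog] := pselect (exists J, F J /\ good J); last first.
    left; apply/seteqP; split=> // x [X FX Xx].
    have [X0|gX] := FZ _ FX; first by rewrite -X0.
    by case: nog; exists X.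
  have gF X x : F X -> X x -> good X.
    by move=> FX Xx; case: (FZ _ FX) => // X0; rewrite X0 in Xx.
  right; have [[J_0 _ _] J0J _] := gJ; split.
  - split; first by exists J.
    + move=> x y [X FX Xx] [Y FY Yy].
      have [[X0 XD XZ] _ _] := gF _ _ FX Xx.
      have [[Y0 YD YZ] _ _] := gF _ _ FY Yy.
      case: (Ftot _ _ FX FY) => sub; [exists Y | exists X] => //.
        by apply: YD => //; apply: sub.
      by apply: XD => //; apply: sub.
    + move=> r x [X FX Xx]; exists X => //.
      by have [[_ _ XZ] _ _] := gF _ _ FX Xx; apply: XZ.
  - by move=> x /J0J Jx; exists J.
  - by move=> x Dx [X FX Xx]; have [_ _ /(_ x Dx)] := gF _ _ FX Xx.
have gJ : good J.
  case: ZJ => // J0E; case: (Jmax J0); last by right.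
  split; first by rewrite J0E.
  by move=> /(_ 0); rewrite J0E; apply; case: sJ0.
have [sJ J0J DJ] := gJ; have [J_0 JD JZ] := sJ; exists J; split=> // x nJx.
(* For [x] outside [J], the larger submodule [J + A x] must meet [D]. *)
pose K := [set z : M | exists a y, J y /\ z = a *: x + y].
apply: contrapT => nD; apply: (Jmax K).
  split; first by move=> y Jy; exists 0, y; rewrite scale0r add0r.
  move=> KJ; apply/nJx/KJ; exists 1, 0.
  by rewrite scale1r addr0.
right; split.
- split; first by exists 0, 0; rewrite scale0r addr0.
  + move=> _ _ [a [y [Jy ->]]] [a' [y' [Jy' ->]]]; exists (a + a'), (y + y').
    by split; [exact: JD | rewrite scalerDl addrACA].
  + move=> r _ [a [y [Jy ->]]]; exists (r * a), (r *: y).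
    by split; [exact: JZ | rewrite scalerDr scalerA].
- by move=> y /J0J Jy; exists 0, y; rewrite scale0r add0r.
- by move=> z Dz [a [y [Jy zE]]]; apply: nD; exists a, y; rewrite -zE.
Qed.

Section LyingOver.
Variables (R S : comPzRingType) (f : {rmorphism R -> S}).
Hypothesis f_fin : finite_morphism f.
Variable P : prime_ideal R.

(* [Q] is chosen maximal among the ideals disjoint from [f (R \ P)]; the last
   clause is this maximality and says that [S / Q] is algebraic over [R / P]. *)
Lemma lying_over : dominant f ->
  exists Q : prime_ideal S,
    (forall r, prime_set Q (f r) <-> prime_set P r) /\
    forall x, ~ prime_set Q x ->
      exists2 r, ~ prime_set P r & exists y, prime_set Q (f r - y * x).
Proof.
move=> f_dom; have [s sT] := f_fin.
have spanT (x : restr f S^o) : lspan s x by rewrite sT.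
(* Dominance: the kernel of [f] lies in the contraction of every prime of [S], hence in [P]. *)
have kerP r : f r = 0 -> prime_set P r.
  move=> fr0; apply: (f_dom [set r | f r = 0]) fr0 => [|Q r' /= ->].
    split=> [|x y /= ex ey|x y /= ey]; first by rewrite /= rmorph0.
      by rewrite rmorphD ex ey addr0.
    by rewrite rmorphM ey mulr0.
  by have [[]] := prime_setP Q.
have [ps0 psD psZ] := prime_span_submod P s.
pose PS : set S^o := prime_span P s.
pose D : set S^o := [set x | exists2 r, ~ prime_set P r & x = f r].
have sPS : is_submod PS.
  split=> // t x; apply: (@prime_span_sub _ P _ s [set x | PS (t *: (x : S^o))]).
  - by rewrite /= scaler0.
  - by move=> y z ty tz; rewrite /= scalerDr; apply: psD.
  - move=> r i Pr _; rewrite /PS /=.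
    suff <- : (r *: (t * (s`_i : S) : restr f S^o) : S^o) =
        t *: ((r *: s`_i : restr f S^o) : S^o) by exact: prime_span_scale.
    exact: (mulrCA (f r) t (s`_i : S)).
have DPS x : D x -> ~ PS x.
  (* If [f u] lay in [P S], Nakayama would give [w] outside [P] with [w S = 0], so [f w = 0],
     against [kerP]. *)
  move=> [u nu ->] PSu; have [i ilt|w nw ws] := @nakayama_prime _ P _ s u nu.
    by rewrite restr_scaleE [_ *: _]mulrC; case: sPS => _ _; apply.
  apply/nw/kerP; have := ws (1 : S) (spanT 1).
  by rewrite restr_scaleE [_ *: _]mulr1.
have [J [sJ PSJ DJ Jmax]] := max_submod sPS DPS.
have [J0 JD JZ] := sJ.
have D1 r : ~ prime_set P r -> ~ J (f r) by move=> nr; apply: DJ; exists r.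
have J_prime : is_prime_ideal (J : set S).
  split=> //.
    by rewrite -(rmorph1 f); apply: D1; apply: prime1.
  (* For [x], [y] outside [J], both [J + S x] and [J + S y] meet [f (R \ P)]; the product of the two
     elements found would lie in [J]. *)
  move=> x y Jxy; apply: contrapT => /not_orP[/Jmax[a [j [Jj [r nr rE]]]]].
  move=> /Jmax[a' [j' [Jj' [r' nr' rE']]]].
  apply: (D1 _ (primeM nr nr')).
  have JM (u v : S) : J v -> J (u * v) by apply: JZ.
  have -> : f (r * r') = (a * a') * (x * y) + (a * x * j' + (a' * y + j') * j).
    have rfE : f r = a * x + j := esym rE.
    have rfE' : f r' = a' * y + j' := esym rE'.
    by rewrite rmorphM rfE rfE'; ring.
  by apply/JD; [exact: JM | apply/JD; exact: JM].
exists (PrimeIdeal J_prime); split=> [r|x /Jmax[a [j [Jj [r nr rE]]]]].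
  split=> [Jr|Pr]; first by apply: contrapT => /D1.
  apply: PSJ; have := prime_span_scale Pr (spanT (1 : S)).
  by rewrite restr_scaleE [_ *: _]mulr1.
have rfE : f r = a * x + j := esym rE.
by exists r => //; exists a; rewrite rfE addrC addKr.
Qed.

Variables (p : nat) (C : cartier_algebra p R) (M : cmodule C).

(* Composing [m] with a functional [S -> R / P] that vanishes on [Q] and not
   at 1.  Its kernel [J] is a maximal submodule disjoint from [f (R \ P)]: then
   [S / J] has rank one over [R / P]. *)
Lemma hom_extension (Q : prime_ideal S) (m : M) :
  (forall r, prime_set Q (f r) <-> prime_set P r) ->
  (forall r, prime_set P r -> r *: m = 0) ->
  exists2 u, ~ prime_set P u & exists g : homR f M,
    homR_app g 1 = u *: m /\ forall x, prime_set Q x -> homR_app g x = 0.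
Proof.
move=> QP Pm; have [s sT] := f_fin; have [[Q0 QD QM] _ _] := prime_setP Q.
pose L := restr f S^o.
pose D : set L := [set x | exists2 r, ~ prime_set P r & x = f r].
have sQ : is_submod (prime_set Q : set L) by split=> // r x; apply: QM.
have [|J [sJ QJ DJ Jmax]] := @max_submod _ L _ D sQ.
  by move=> _ [r nr ->] /QP.
have [J0 JD JZ] := sJ.
have JP r : J (f r) -> prime_set P r.
  by move=> Jr; apply: contrapT => nr; apply: DJ Jr; exists r.
(* [X] is [f R + J]. That [S / J] has rank one means that some [a] outside [P] moves all of [S] into
   [X]. *)
pose X : set L := [set x | exists r, J (x - f r : S)].
have sX : is_submod X.
  split=> [|x y [r Jr] [r' Jr']|c x [r Jr]].
  - by exists 0; rewrite rmorph0 subrr.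
  - by exists (r + r'); rewrite rmorphD opprD addrACA; apply: JD.
  - by exists (c * r); have := JZ c _ Jr; rewrite rmorphM scalerBr.
have [i ilt|a na aX] := common_denominator (P := P) (s := s) sX.
  have [Ji|/Jmax[b [y [Jy [r nr rE]]]]] := pselect (J s`_i).
    by exists 1; [exact: prime1 | exists 0; rewrite rmorph0 subr0 scale1r].
  exists b; last by exists r; rewrite -rE opprD addrA subrr add0r; apply: submodN.
  move=> Pb; apply: (DJ (f r)); first by exists r.
  by rewrite -rE; apply: JD => //; apply/QJ; rewrite [_ *: _]mulrC; apply/QM/QP.
have spanT (x : L) : lspan s x by rewrite sT.
have [h hP] := choice (fun x => aX x (spanT x)).
(* [h x] is determined modulo [P], which kills [m], so [h x *: m] does not depend on the choice of
   [h]. *)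
have h_uniq x r : J ((a *: (x : L) : S) - f r) -> h x *: m = r *: m.
  move=> Jr; apply/eqP; rewrite -subr_eq0 -scalerBl; apply/eqP/Pm/JP.
  have := submodB sJ Jr (hP x); rewrite opprB addrC addrA subrK.
  by rewrite rmorphB.
have hlin : homR_pred f (fun x => h x *: m).
  apply/asboolP => r x y; rewrite scalerA -scalerDl; apply: h_uniq.
  have -> : ((a *: (f r * x + y : L) : S) - f (r * h x + h y))
      = r *: ((a *: (x : L)) - f (h x) : L) + ((a *: (y : L)) - f (h y)) :> S.
    rewrite !restr_scaleE rmorphD rmorphM.
    change (f a * (f r * x + y) - (f r * f (h x) + f (h y)) =
      f r * (f a * x - f (h x)) + (f a * y - f (h y))).
    by ring.
  by apply: JD; [apply: JZ; exact: hP | exact: hP].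
(* Since [a *: 1 = f a], the coefficient [a] may replace [h 1]: the value at 1 is [a *: m]. *)
exists a => //; exists (Sub _ hlin : homR f M); split.
  apply: h_uniq; rewrite restr_scaleE [_ *: _]mulr1 subrr //.
move=> x Qx; apply: etrans (scale0r m); apply: h_uniq.
by rewrite rmorph0 subr0; apply: JZ; apply: QJ.
Qed.

End LyingOver.

(** * Powers of [C_+] and their pullbacks *)

Section PlusPow.
Variables (p : nat) (R : comPzRingType) (C : cartier_algebra p R).

Lemma plus_pow_deg k e (a : C e) : plus_pow k a -> (k <= e)%N \/ a = 0.
Proof.
elim=> {k e a} [e a|k e d n h a b e0 _ [kd|->]|k e|k e a b _ IHa _ IHb].
- by left.
- by left; rewrite -h -add1n leq_add.
- by right; rewrite cmul0r.
- by right.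
- by case: IHa IHb => [ke|->] [ke'|->]; auto; rewrite addr0; right.
Qed.

(** Products from [C_+ ^ k] and [C_+ ^ l] additively generate [C_+ ^ (k + l)]; testing on an
    additive set [X] avoids writing sums. *)
Lemma plus_pow_split k l n (c : C n) (X : set (C n)) :
  plus_pow (k + l) c -> X 0 -> (forall x y, X x -> X y -> X (x + y)) ->
  (forall e d (h : (e + d)%N = n) (a : C e) (b : C d),
    plus_pow k a -> plus_pow l b -> X (cmul h a b)) ->
  X c.
Proof.
elim: k n c X => [|k IH] n c X.
  move=> cl _ _ Xm; rewrite -(cmul1l (add0n n) c); apply: Xm => //.
  exact: plus_pow0.
rewrite addSn; move iE: (k + l).+1 => i ci.
elim: ci X iE => {i n c} [e a X|i e d n h a b e0 bi _ X|i e X|i e a b _ IHa _ IHb X].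
- by [].
- move=> [iE] X0 XD Xm; rewrite -iE in bi.
  apply: (IH d b [set x | X (cmul h a x)] bi) => [|x y Xx Xy|].
  + by rewrite /= cmul0r.
  + by rewrite /= cmulDr; apply: XD.
  + move=> e' d' h' a' b' ka' lb'.
    have h2 : (e + e' + d')%N = n by rewrite -addnA h'.
    rewrite /= (cmulA (erefl (e + e')%N) h2).
    by apply: Xm => //; apply: plus_powM.
- by [].
- by move=> iE X0 XD Xm; apply: (XD _ _); [apply: IHa | apply: IHb].
Qed.

Lemma kills_act (P : prime_ideal R) (M : cmodule C) n e (c : C e) (m : M) :
  kills P n m -> kills P n (act c m).
Proof.
move=> km s ss sP; rewrite act_semilin.
have : (0 < p ^ e)%N by rewrite expn_gt0 prime_gt0 // (cartier_prime C).
by case: (p ^ e)%N => // q _; rewrite exprSr -scalerA km // scaler0 act0r.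
Qed.

(** [r c(m) = c(r^q m)] with [q = p^e], and a nonzero [c] has degree [e >= n], so [q >= n]. *)
Lemma kills_plus_pow (P : prime_ideal R) (M : cmodule C) n e (c : C e) (m : M) r :
  plus_pow n c -> kills P n m -> prime_set P r -> r *: act c m = 0.
Proof.
move=> /plus_pow_deg[ne|->] km Pr; last by rewrite act0l scaler0.
have nq : (n <= p ^ e)%N.
  apply: leq_trans ne (ltnW (ltn_expl _ _)).
  exact: prime_gt1 (cartier_prime C).
rewrite act_semilin.
have := kills_leq nq km (size_nseq (p ^ e) r).
rewrite big_nseq iter_mulr_1 => ->; first exact: act0r.
by move=> t; rewrite mem_nseq => /andP[_ /eqP->].
Qed.

End PlusPow.

Section PullbackPlusPow.
Variables (p : nat) (R S : comPzRingType) (f : {rmorphism R -> S}).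
Variable C : cartier_algebra p R.

Lemma pb_tens0l e s : pb_tens f (0 : C e) s = 0.
Proof. by apply: (addrI (pb_tens f (0 : C e) s)); rewrite -pb_tensDl !addr0. Qed.

(** [(a (x) 1) (b (x) s) = ab (x) s] transfers the factors one by one. *)
Lemma plus_pow_tens k e (a : C e) s :
  plus_pow k a -> plus_pow k (pb_tens f a s : pullback f C e).
Proof.
elim=> {k e a} [e a|k e d n h a b e0 _ IH|k e|k e a b _ IHa _ IHb].
- exact: plus_pow0.
- suff <- : cmul h (pb_tens f a 1 : pullback f C e) (pb_tens f b s)
      = pb_tens f (cmul h a b) s by exact: plus_powM.
  by rewrite [LHS]pb_mulE expr1n mul1r.
- by rewrite pb_tens0l; apply: plus_pow_zero.
- by rewrite pb_tensDl; apply: plus_powD.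
Qed.

(** A product of pure tensors is pure, with first component the product in [C]; so pure tensors over
    [C_+ ^ k] span the [k]-th power in the pullback. *)
Lemma pullback_plus_pow k n (c : pullback f C n) (X : set (pullback f C n)) :
  plus_pow k c -> X 0 -> (forall x y, X x -> X y -> X (x + y)) ->
  (forall (a : C n) s, plus_pow k a -> X (pb_tens f a s)) -> X c.
Proof.
move=> kc; elim: kc X =>
  {k n c} [e a|k e d n h a b e0 _ IH|k e|k e a b _ IHa _ IHb] X X0 XD Xt.
- apply: pb_ind a => // a s; apply: Xt; exact: plus_pow0.
- move: a; apply: pb_ind => [|a s|x y Xx Xy].
  + by rewrite cmul0l.
  + apply: (IH [set b | X (cmul h (pb_tens f a s : pullback f C e) b)]).
    * by rewrite /mkset cmul0r.
    * by move=> x y Xx Xy; rewrite /mkset cmulDr; apply: XD.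
    * move=> b' t kb'; rewrite /mkset [cmul _ _ _]pb_mulE; apply: Xt.
      exact: plus_powM.
  + by rewrite cmulDl; apply: XD.
- by [].
- by apply: (XD _ _); [apply: IHa | apply: IHb].
Qed.

End PullbackPlusPow.

(** * Nil-isomorphisms with denominators cleared *)

Section LocalNilIso.
Variables (p : nat) (R : comPzRingType) (C : cartier_algebra p R).
Variables (M : cmodule C) (N : csubmod M).

Lemma csub_submod : is_submod (N : set M).
Proof.
split; [exact: csub0 | exact: csubD | ].
by move=> r x Nx; rewrite -act_scal; apply: csub_act.
Qed.

(** The exponent [k] is chosen before [n]: it must serve torsion of every order. *)
Definition local_nil : Prop := forall P : prime_ideal R, Ass M P ->
  exists k, forall e (c : C e), plus_pow k c ->
    forall n (m : M), kills P n m -> saturation P N (act c m).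

Let kills_frac (P : prime_ideal R) (L : cmodule C) n (m : L) (t : den P) :
  kills P n m -> csub_pred (H0 (loc_cmodule P L)) (Defs.frac m t : loc P L).
Proof.
move=> km; apply/asboolP; exists n => s ss sP.
by rewrite [LHS]locfrac_scale km // [LHS]frac0.
Qed.

Lemma H0_nil_iso_local_nil : H0_nil_iso N -> local_nil.
Proof.
move=> nilN P /nilN[_ [k hk]]; exists k => e c kc n m km.
pose y : csub_cmodule (H0 (loc_cmodule P M)) := Sub _ (kills_frac (den1 P) km).
have [x /(congr1 val) /= xE] := hk e _ (plus_pow_tens (@locmap R P) 1 kc) y.
move: xE; have [nu [t ->]] := frac_ex (val x : loc P (csub_cmodule N)).
rewrite loc_hom_funE [RHS]loc_actE scale1r [RHS]loc_opE => /frac_eqP[u].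
rewrite /= scale1r expr1n scale1r scalerA => uE.
exists (sval u * sval t); first by apply: primeM; apply: denP.
rewrite -uE; case: csub_submod => _ _; apply.
exact/asboolP/(valP nu).
Qed.

Lemma local_nil_H0_nil_iso : noetherian R -> local_nil -> H0_nil_iso N.
Proof.
move=> noethR nilN P /nilN[k hk]; split.
  (* Kernel part: the inclusion of [N] stays injective after localisation. *)
  exists 0%N => e a _ x gx0; suff -> : x = 0 by exact: act0r.
  apply: val_inj; move/(congr1 val): gx0 => /=.
  have [nu [t ->]] := frac_ex (val x : loc P (csub_cmodule N)).
  rewrite loc_hom_funE => x0.
  have /frac_eqP[u] : (Defs.frac (val nu : M) t : loc P M)
      = Defs.frac 0 (den1 P) by rewrite frac0.
  rewrite !scaler0 scale1r => uE; apply: etrans (frac0 _ (den1 P)).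
  by apply/frac_eqP; exists u; rewrite !scaler0 scale1r; apply: val_inj.
exists k => e a ka y.
pose X := [set a : loc_alg C P e |
  exists x, H0_hom (loc_hom P (csub_incl N)) x = act a y].
apply: (pullback_plus_pow (X := X) ka) => {a ka} [|a b [x ax] [x' bx']|c s kc].
- by exists 0; rewrite chom0 act0l.
- by exists (x + x'); rewrite chomD ax bx' actDl.
have [m [t mt]] := frac_ex (s *: val y : loc P M).
have [n hn] : P_power_torsion (s *: val y : loc_cmodule P M).
  have [n hn] : P_power_torsion (val y) by apply/asboolP/(valP y).
  by exists n => l sl lP; rewrite scalerA mulrC -scalerA hn // scaler0.
rewrite [_ *: val y]mt in hn.
have [u nu ku] := loc_kills noethR hn.
have [q qE] : exists q, (p ^ e)%N = q.+1.
  exists (p ^ e).-1; rewrite prednK // expn_gt0 prime_gt0 //.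
  exact: cartier_prime C.
(* [c] sends [m / t] to [z / t], and [u *: z] is the image under [c] of an element killed by
   [P ^ n]. *)
pose z := act c (sval t ^+ q *: m).
have uzE : u *: z = act c ((sval t ^+ q * u ^+ q) *: (u *: m)).
  by rewrite act_semilin qE !scalerA exprSr mulrAC -mulrA [_ * _ ^+ q]mulrC -!mulrA.
have kuz : kills P n (u *: z).
  rewrite uzE; apply: kills_act; case: (kills_submod P M n) => _ _; exact.
have [v nv Nvz] : saturation P N (u *: z).
  rewrite uzE; apply: (hk _ _ kc n).
  by case: (kills_submod P M n) => _ _; apply.
pose nv' : csub_cmodule N := Sub (v *: (u *: z)) (asboolT Nvz).
have kn : kills P n nv'.
  move=> l sl lP; apply: val_inj; rewrite [LHS]linearZ /=.
  by rewrite scalerA mulrC -scalerA kuz // scaler0.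
(* [nv' / w] is [(v u z) / (v u t)], which equals [z / t]. *)
pose w : den P := denM (exist (den_pred P) _ (asboolT (primeM nv nu))) t.
exists (Sub _ (kills_frac w kn)); apply: val_inj.
rewrite /= [LHS]loc_hom_funE [RHS]loc_actE mt loc_opE qE /= -/z.
by apply: frac_eq; rewrite /= !scalerA; congr (_ *: _); ring.
Qed.

End LocalNilIso.

(** The [P]-power torsion of [M] is finitely generated; the largest exponent among its generators
    suffices. *)
Lemma kills_bounded (R : comPzRingType) (P : prime_ideal R) (M : lmodType R) :
  noetherian R -> fin_gen M ->
  exists k, forall n (m : M), kills P n m -> kills P k m.
Proof.
move=> noethR [s sT].
pose X := [set m : M | exists n, kills P n m].
have sX : is_submod X.
  split=> [|x y [n kx] [k ky]|r x [n kx]].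
  - by exists 0%N; case: (kills_submod P M 0).
  - have [_ kD _] := kills_submod P M (maxn n k); exists (maxn n k).
    by apply: kD; [apply: kills_leq kx | apply: kills_leq ky];
      rewrite ?leq_maxl ?leq_maxr.
  - by exists n; case: (kills_submod P M n) => _ _; apply.
have [|t Xt] := sub_lspan_fin_gen noethR sX (s := s); first by rewrite sT.
have bound i : exists n, (i < size t)%N -> kills P n t`_i.
  case: (ltnP i (size t)) => [it|]; last by exists 0%N.
  by have : X t`_i; [rewrite Xt; apply: lspan_nth | case=> n; exists n].
have [b bP] := choice bound.
exists (\max_(i < size t) b i)%N => n m km.
have : X m by exists n.
rewrite Xt; apply: lspan_sub => [|i it]; first exact: kills_submod.
by apply: kills_leq (bP i it); apply: (leq_bigmax (Ordinal it)).
Qed.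

(** * Contraction of primes and the trace map *)

Lemma preim_prime_subproof (R S : comPzRingType) (f : {rmorphism R -> S})
  (Q : prime_ideal S) : is_prime_ideal (f @^-1` prime_set Q).
Proof.
have [[Q0 QD QM] Q1 QP] := prime_setP Q; split.
- split=> [|x y Qx Qy|r x Qx]; rewrite /preimage /mkset.
  + by rewrite rmorph0.
  + by rewrite rmorphD; apply: QD.
  + by rewrite rmorphM; apply: QM.
- by rewrite /preimage /mkset rmorph1.
- by move=> x y; rewrite /preimage /mkset rmorphM; apply: QP.
Qed.

Definition preim_prime (R S : comPzRingType) (f : {rmorphism R -> S})
  (Q : prime_ideal S) : prime_ideal R := PrimeIdeal (preim_prime_subproof f Q).

Section Trace.
Variables (p : nat) (R S : comPzRingType) (f : {rmorphism R -> S}).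
Hypothesis f_fin : finite_morphism f.
Variables (C : cartier_algebra p R) (M : cmodule C).

Lemma homR_appZ (s : S) (g : homR f M) x :
  homR_app (s *: g) x = homR_app g (x * s).
Proof. by []. Qed.

Lemma TrD (g h : upper_shriek f M) : Tr (g + h) = Tr g + Tr h.
Proof. exact: homR_appD. Qed.

Lemma TrZ r (g : upper_shriek f M) : Tr (f r *: g) = r *: Tr g.
Proof.
by rewrite /Tr [homR_app _ _]homR_appZ mul1r -{1}(mulr1 (f r)) homR_scale.
Qed.

Lemma Tr_act e (c : C e) (g : upper_shriek f M) :
  Tr (act (pb_tens f c 1 : pullback f C e) g) = act c (Tr g).
Proof. by rewrite /Tr upper_shriek_actE expr1n mulr1. Qed.

(** Some value of [g] at a generator of [S] has annihilator [P]. Otherwise elements outside [P] kill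
    these values one by one, and for their product [a] the element [f a], outside [Q], kills [g]. *)
Lemma Ass_preim (Q : prime_ideal S) :
  Ass (upper_shriek f M) Q -> Ass M (preim_prime f Q).
Proof.
move=> [g Qg]; have [s sT] := f_fin; set P := preim_prime f Q.
have QE x : prime_set Q x <-> x *: g = 0 by rewrite Qg.
have [[i [ilt iP]]|noi] := pselect (exists i, (i < size s)%N /\
    forall r, r *: homR_app g s`_i = 0 -> prime_set P r).
  exists (homR_app g s`_i); apply/seteqP; split=> r /=; last exact: iP.
  move=> /QE /(congr1 (fun h : homR f M => homR_app h s`_i)).
  by rewrite homR_appZ mulrC homR_scale.
pose X : set (restr f S^o) := [set x | homR_app g x = 0].
have sX : is_submod X.
  split=> [|x y /= ex ey|r x /= ex]; first exact: homR_0.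
    by rewrite /X /mkset [LHS]homR_addr ex ey addr0.
  by rewrite /X /mkset [LHS]homR_scale ex scaler0.
have [i ilt|a na aX] := common_denominator (P := P) (s := s) sX.
  apply: contrapT => nX; apply: noi; exists i; split=> // r ri.
  apply: contrapT => nr; apply: nX; exists r => //.
  by rewrite /X /mkset [LHS]homR_scale.
case: na; apply/QE/homR_ext => x; rewrite homR_appZ mulrC.
by apply: aX; rewrite sT.
Qed.

Lemma shriek_sub_act (N : csubmod M) e (a : pullback f C e) (g : upper_shriek f M) :
  (forall x, csub_set N (homR_app g x)) ->
  forall x, csub_set N (homR_app (act a g) x).
Proof.
move=> Ng; move: a; apply: pb_ind => [|a s|a b IHa IHb] x.
- by rewrite act0l; apply: csub0.
- by rewrite upper_shriek_actE; apply: csub_act.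
- by rewrite actDl homR_appD; apply: csubD.
Qed.

(** [Hom_R(S, N)] inside [Hom_R(S, M)]. *)
Definition shriek_sub (N : csubmod M) : csubmod (upper_shriek f M) :=
  @CSubmod p S (pullback f C) (upper_shriek f M)
    [set g : upper_shriek f M | forall x, csub_set N (homR_app g x)]
    (fun x => csub0 N)
    (fun g h Ng Nh x => eq_ind_r (csub_set N) (csubD (Ng x) (Nh x))
      (homR_appD g h x))
    (@shriek_sub_act N).

(** If [Q ^ n] kills [g], then [P ^ n] kills its values, so [c] brings each into [N] up to a
    denominator. Finiteness of [S] gives a common one [a], and [f a] is outside [Q]. *)
Lemma shriek_sub_local_nil (N : csubmod M) :
  local_nil N -> local_nil (shriek_sub N).
Proof.
move=> nilN Q AQ; set P := preim_prime f Q.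
have [k hk] := nilN P (Ass_preim AQ); have [s sT] := f_fin.
exists k => e c kc n g kg.
have [sat0 satD satZ] := saturation_submod Q (csub_submod (shriek_sub N)).
apply: (pullback_plus_pow (X := [set c | saturation Q (shriek_sub N) (act c g)]) kc)
  => {c kc} [|c c' Xc Xc'|c t kc].
- by rewrite /mkset act0l.
- by rewrite /mkset actDl; apply: satD.
have kx x : kills P n (homR_app g x).
  move=> l sl lP; rewrite -homR_scale mulrC -homR_appZ rmorph_prod.
  rewrite -(big_map f xpredT id) [_ *: g]kg ?size_map //.
  by move=> y /mapP[r /lP Pr ->].
rewrite /mkset; set h := act _ g.
have hx x : saturation P N (homR_app h x).
  by rewrite upper_shriek_actE; apply: hk kc _ _ (kx _).
have [N0 ND NZ] := csub_submod N.
pose X : set (restr f S^o) := [set x | csub_set N (homR_app h x)].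
have sX : is_submod X.
  split=> [|x y Nx Ny|r x Nx]; rewrite /X /mkset.
  - by rewrite [homR_app _ _]homR_0.
  - by rewrite [homR_app _ _]homR_addr; apply: ND.
  - by rewrite [homR_app _ _]homR_scale; apply: NZ.
have [i ilt|a na aX] := common_denominator (P := P) (s := s) sX.
  have [u nu Nu] := hx s`_i; exists u => //.
  by rewrite /X /mkset [homR_app _ _]homR_scale.
exists (f a) => // x; rewrite [homR_app _ _]homR_appZ mulrC.
by apply: aX; rewrite sT.
Qed.

Lemma trace_sub_act (T : csubmod (upper_shriek f M)) e (a : C e) (m : M) :
  (@Tr p R S f C M @` T) m -> (@Tr p R S f C M @` T) (act a m).
Proof.
move=> [g Tg <-]; exists (act (pb_tens f a 1 : pullback f C e) g).
  exact: csub_act.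
exact: Tr_act.
Qed.

Lemma trace_sub0 (T : csubmod (upper_shriek f M)) : (@Tr p R S f C M @` T) 0.
Proof. by exists 0; [exact: csub0 | ]. Qed.

Lemma trace_subD (T : csubmod (upper_shriek f M)) (m n : M) :
  (@Tr p R S f C M @` T) m -> (@Tr p R S f C M @` T) n ->
  (@Tr p R S f C M @` T) (m + n).
Proof.
by move=> [g Tg <-] [h Th <-]; exists (g + h); [exact: csubD | exact: TrD].
Qed.

Definition trace_sub (T : csubmod (upper_shriek f M)) : csubmod M :=
  CSubmod (trace_sub0 T) (@trace_subD T) (@trace_sub_act T).

Lemma trace_sub_local_nil (T : csubmod (upper_shriek f M)) :
  noetherian R -> dominant f -> fin_gen M ->
  local_nil T -> local_nil (trace_sub T).
Proof.
move=> noethR f_dom M_fg nilT P [m0 Pm0].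
have [Q [QP Qalg]] := lying_over f_fin P f_dom.
have [Q0 QD QM] : is_ideal (prime_set Q) by case: (prime_setP Q).
(* [Q] is the annihilator of [g]: if [x] outside [Q] killed [g], so would [f r] for some [r] outside
   [P], and [r * u] would kill [m0]. *)
have AQ : Ass (upper_shriek f M) Q.
  have [|u nu [g [g1 gQ]]] := hom_extension f_fin (m := m0) QP.
    by move=> r; rewrite Pm0.
  exists g; apply/seteqP; split=> [x Qx|x /= xg].
    by apply: homR_ext => y; rewrite homR_appZ gQ //; apply: QM.
  apply: contrapT => /Qalg[r nr [y Qy]].
  apply: (primeM nr nu); rewrite Pm0 /= -scalerA -g1 -TrZ.
  suff -> : f r *: (g : upper_shriek f M) = 0 by [].
  rewrite -(subrK (y * x) (f r)) scalerDl -scalerA xg scaler0 addr0.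
  by apply: homR_ext => z; rewrite [homR_app _ _]homR_appZ gQ //; apply: QM.
have [k hk] := nilT Q AQ; have [n0 hn0] := kills_bounded P noethR M_fg.
(* [n0] bounds all torsion exponents: [C_+ ^ n0] produces elements killed by [P], and [C_+ ^ k] then
   leads into the trace of [T]. *)
exists (k + n0)%N => e c kc n m /hn0 km.
have [sat0 satD satZ] := saturation_submod P (csub_submod (trace_sub T)).
apply: (plus_pow_split (X := [set c | saturation P (trace_sub T) (act c m)]) kc).
- by rewrite /mkset act0l.
- by move=> c1 c2 Xc1 Xc2; rewrite /mkset actDl; apply: satD.
move=> e1 e2 h a b ka kb; rewrite /mkset actM; set m' := act b m.
have Pm' r : prime_set P r -> r *: m' = 0 by exact: kills_plus_pow kb km.
have q_gt0 : (0 < p ^ e1)%N by rewrite expn_gt0 prime_gt0 // (cartier_prime C).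
have [u nu [g0 [g01 g0Q]]] := hom_extension f_fin QP Pm'.
(* With [q = p ^ e1], the factor [u ^ (q - 1)] gives [Tr g = u ^ q m'], and
   [a (u ^ q m') = u a(m')]. *)
pose g : upper_shriek f M := f u ^+ (p ^ e1).-1 *: (g0 : upper_shriek f M).
have g1 : Tr g = u ^+ (p ^ e1) *: m'.
  by rewrite /g -rmorphXn TrZ /Tr g01 scalerA -exprSr prednK.
pose ga : upper_shriek f M := act (pb_tens f a 1 : pullback f C e1) g.
have Qg x : prime_set Q x -> x *: g = 0.
  move=> Qx; rewrite scalerA; apply: homR_ext => y.
  by rewrite [homR_app _ _]homR_appZ g0Q //; apply/QM; rewrite mulrC; apply/QM.
have Qga x : prime_set Q x -> x *: ga = 0.
  move=> Qx; rewrite act_semilin; case: (p ^ e1)%N q_gt0 => // q _.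
  by rewrite exprSr -scalerA Qg // scaler0 act0r.
have [v nv Tv] : saturation Q T ga.
  apply: (hk _ _ (plus_pow_tens f 1 ka) 1%N).
  by move=> [//|x [|//]] _ sQ; rewrite big_seq1 Qg //; apply: sQ; rewrite inE.
(* [f r] agrees with [y * v] modulo [Q], which kills [ga]; this trades the denominator [v] in [S]
   for [r] in [R]. *)
have [r nr [y Qy]] := Qalg v nv.
exists (r * u); first exact: primeM.
rewrite -scalerA act_semilin; exists (f r *: ga).
  rewrite -(subrK (y * v) (f r)) scalerDl Qga // add0r -scalerA.
  by have [_ _] := csub_submod T; apply.
by rewrite TrZ Tr_act g1.
Qed.

End Trace.

(** * Test modules and F-regularity under the trace *)

Lemma test_module_unique (p : nat) (R : comPzRingType) (C : cartier_algebra p R)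
  (M : cmodule C) (N N' : csubmod M) :
  is_test_module N -> is_test_module N' -> N = N' :> set M.
Proof.
by move=> [nN minN] [nN' minN']; apply/seteqP; split; [exact: minN | exact: minN'].
Qed.

Theorem theoremA (p : nat) (R S : comPzRingType) (f : {rmorphism R -> S})
  (p_prime : prime p) (charR : char_p p R) (charS : char_p p S)
  (noethR : noetherian R) (noethS : noetherian S)
  (FfinR : F_finite p R) (FfinS : F_finite p S)
  (f_finite : finite_morphism f) (f_dominant : dominant f)
  (C : cartier_algebra p R) (M : cmodule C) (M_fg : fin_gen M)
  (tau_M : csubmod M) (tau_fM : csubmod (upper_shriek f M)) :
  is_test_module tau_M -> is_test_module tau_fM ->
  [/\ @Tr p R S f C M @` tau_fM = tau_M :> set M,
      F_regular M ->
        (forall m : M, exists mu : upper_shriek f M, Tr mu = m) &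
      (forall m : M, exists mu : upper_shriek f M, Tr mu = m) ->
        F_regular (upper_shriek f M) -> F_regular M].
Proof.
move=> tauM taufM.
have TrE : @Tr p R S f C M @` tau_fM = tau_M :> set M.
  apply/seteqP; split=> [_ [g tg <-]|].
    (* Minimality puts [tau_fM] inside [Hom_R(S, tau_M)], whose elements take a value in [tau_M] at
       1. *)
    apply: (taufM.2 (shriek_sub f tau_M) _ g tg).
    apply: local_nil_H0_nil_iso noethS _; apply: shriek_sub_local_nil => //.
    exact: H0_nil_iso_local_nil tauM.1.
  apply: (tauM.2 (trace_sub tau_fM)).
  apply: (local_nil_H0_nil_iso noethR).
  exact: trace_sub_local_nil noethR f_dominant M_fg
    (H0_nil_iso_local_nil taufM.1).
(* By uniqueness, the test module [N] witnessing F-regularity is [tau_M], respectively [tau_fM]. *)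
split=> // [[N [tN NT]] m|Tr_surj [N [tN NT]]].
  have : csub_set tau_M m by rewrite (test_module_unique tauM tN) NT.
  by rewrite -TrE => -[g _ gm]; exists g.
exists tau_M; split=> //; rewrite -TrE; apply/seteqP; split=> // m _.
have [g gm] := Tr_surj m; exists g => //.
by rewrite (test_module_unique taufM tN) NT.
Qed.
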